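(* Fix $j\in\mathbb N$ and write $\phi=\phi_j$, $\lambda=\lambda_j$. Let $0<x\le1$. If $\phi'(x)$ exists, then $$|\phi'(x)|<\frac{(3+\log|\lambda|)\lambda^2}{x^2}.$$
   Context: Let $K:[0,1]\times[0,1]\to\mathbb R$ be defined by $K(x,y)=\frac12-\{(xy)^{-1}\}$ if $0<x,y\le 1$, and $K(x,y)=0$ if $0\le x,y\le1$ and $xy=0$, where $\{\alpha\}=\alpha-\lfloor\alpha\rfloor$. Let $L^2([0,1])$ denote the space of real-valued Lebesgue measurable square-integrable functions on $[0,1]$, with $\langle f,g\rangle=\int_0^1 f(x)g(x)\,dx$ and $\|f\|=\langle f,f\rangle^{1/2}$. A function $\phi$ is an eigenfunction of $K$ (with eigenvalue $\lambda\in\mathbb R$) if $\phi\in L^2([0,1])$, $\|\phi\|>0$, and $\phi(x)=\lambda\int_0^1 K(x,y)\phi(y)\,dy$ for every $x\in[0,1]$. Let $\phi_1,\phi_2,\ldots$ be a maximal orthonormal system in $L^2([0,1])$ of eigenfunctions of $K$, $\phi_j$ having the nonzero real eigenvalue $\lambda_j$, numbered so that $0<|\lambda_1|\le|\lambda_2|\le\cdots$ and $\lambda_j\ge\lambda_{j+1}$ whenever $|\lambda_j|=|\lambda_{j+1}|$. At $x=1$, $\phi'(1)$ means the left-hand derivative (the domain of $\phi$ being $[0,1]$). *)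

(* Defs.v *)
From HB Require Import structures.
From mathcomp Require Import all_boot all_order all_algebra.
From mathcomp Require Import all_classical all_reals all_analysis.
Set Implicit Arguments. Unset Strict Implicit. Unset Printing Implicit Defensive.
Import Order.TTheory GRing.Theory Num.Theory.
Import numFieldNormedType.Exports.
Local Open Scope classical_set_scope.
Local Open Scope ring_scope.

Section Defs.
Variable R : realType.

Definition fracR (a : R) : R := a - (Num.floor a)%:~R.

Definition Kker (x y : R) : R :=
  if x * y == 0 then 0 else 2^-1 - fracR ((x * y)^-1).

Definition I01 : set R := `[0%R, 1%R].

Definition L2_01 (f : R -> R) : Prop :=
  measurable_fun I01 f /\
  (\int[@lebesgue_measure R]_(x in I01) ((f x ^+ 2)%:E) < +oo)%E.

Definition inner01 (f g : R -> R) : R :=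
  Rintegral (@lebesgue_measure R) I01 (fun x => f x * g x).

Definition norm01 (f : R -> R) : R := Num.sqrt (inner01 f f).

Definition eigenfun (phi : R -> R) (lam : R) : Prop :=
  L2_01 phi /\ 0 < norm01 phi /\
  forall x, x \in I01 ->
    phi x = lam * Rintegral (@lebesgue_measure R) I01 (fun y => Kker x y * phi y).

(* phi (with domain [0,1]) has derivative d at x in (0,1]; at x = 1 this is
   the left-hand derivative *)
Definition has_deriv01 (phi : R -> R) (x d : R) : Prop :=
  if x < 1 then (fun h : R => h^-1 * (phi (x + h) - phi x)) @ (0:R)^' --> d
  else (fun h : R => h^-1 * (phi (x + h) - phi x)) @ (0:R)^'- --> d.

(* phi_0, phi_1, ... (paper: phi_1, phi_2, ...) is a maximal orthonormal system
   of eigenfunctions, phi j with eigenvalue lam j, ordered as in the paper *)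
Definition eigen_system (phi : nat -> R -> R) (lam : nat -> R) : Prop :=
  (forall j, lam j != 0 /\ eigenfun (phi j) (lam j)) /\
  (forall i j, inner01 (phi i) (phi j) = if i == j then 1 else 0) /\
  (forall psi mu, eigenfun psi mu -> ~ (forall j, inner01 psi (phi j) = 0)) /\
  (0 < `|lam 0%N|) /\
  (forall j, `|lam j| <= `|lam j.+1|) /\
  (forall j, `|lam j| = `|lam j.+1| -> lam j.+1 <= lam j).

End Defs.

(* Main.v *)
(**
Write saw t = 1/2 - {t}, so that K(x,y) = saw (1/(xy)) and
phi x = lam * int_0^1 saw (1/(xy)) phi y dy with ||phi|| = 1; put L = |lam|.

Cauchy-Schwarz gives |phi| <= L/2, hence L >= 2.  Iterating the equation,
phi y = lam^2 * int K2(y,z) phi z dz where K2(y,z) = int saw(1/(yw)) saw(1/(wz)) dw.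
Integrating by parts against the periodic primitive of saw gives
|K2(y,z)| <= min (1/4, y/(4z)), hence the decay |phi y| <= (3/8) L^2 sqrt y.

For x' < x put X = 1/x, X' = 1/x'.  Then saw (X'/y) - saw (X/y) is
-(X' - X)/y plus the number of integers n with X/y < n <= X'/y, so that
|phi x' - phi x| <= L (X' - X) (int |phi y|/y dy + sum_(n > X) sup |phi|/n),
the supremum being over y <= X'/n.  The integral, split at y = L^-2, is at
most (7/4) L: the square-root decay handles small y and ||phi|| = 1 handles
large y.  The sum, with |phi y| <= (L/2) min (1, (3/4) L sqrt y), is at most
(L/2) (3 + 2 ln (3L/4) + ln (X'/X)).  Dividing by x - x' and letting x' -> x
bounds |phi' x| by (13/4 + ln (3/4) + ln L) L^2/x^2, and ln (3/4) < -1/4.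
*)

Require Import Defs.
From HB Require Import structures.
From mathcomp Require Import all_boot all_order all_algebra.
From mathcomp Require Import all_classical all_reals all_analysis.
From mathcomp Require Import measurable_realfun ring lra.
Import Order.TTheory GRing.Theory Num.Theory.
Import numFieldNormedType.Exports.
Local Open Scope ring_scope.

(** * The sawtooth function *)

Section Sawtooth.
Variable R : realType.
Notation mu := (@lebesgue_measure R).
Local Open Scope classical_set_scope.
Implicit Types (s t w Y Z : R) (m k : int).

Definition saw (a : R) : R := 2^-1 - fracR a.

Lemma fracR_itv (a : R) : 0 <= fracR a < 1.
Proof.
have /andP[h1] := floor_itv a; rewrite intrD => h2.
by rewrite /fracR; apply/andP; split; lra.
Qed.

Lemma fracRE (a : R) m : m%:~R <= a < m%:~R + 1 -> fracR a = a - m%:~R.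
Proof. by move=> h; rewrite /fracR (@floor_def _ _ m)// intrD. Qed.

Lemma saw_norm (a : R) : `|saw a| <= 2^-1.
Proof. by have /andP[h1 h2] := fracR_itv a; rewrite /saw ler_norml; lra. Qed.

Lemma measurable_fracR : measurable_fun setT (@fracR R).
Proof.
apply: measurable_funB => //; apply: nondecreasing_measurable => // a b ab.
by rewrite ler_int; exact: le_floor.
Qed.

Lemma measurable_saw : measurable_fun setT saw.
Proof. by apply: measurable_funB => //; exact: measurable_fracR. Qed.

Lemma measurable_inv : measurable_fun setT (fun x : R => x^-1).
Proof.
(* Real powers are measurable, and exponent -1 is inversion on nonnegative reals; hence the square.
   At [x = 0] both sides are 0. *)
rewrite (_ : (fun x => _) = (fun x : R => x * (x ^+ 2) `^ (-1))); last first.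
  apply/funext => x; rewrite powR_inv1 ?sqr_ge0//.
  have [->|x0] := eqVneq x 0; first by rewrite invr0 mul0r.
  by field.
apply: measurable_funM => //.
have := @measurableT_comp _ _ _ _ _ _ _ _ (fun x : R => x ^+ 2) (@measurable_powR R (-1)).
by apply; exact: measurable_funX.
Qed.

Lemma measurable_sawV (X : R) : measurable_fun setT (fun w : R => saw (X / w)).
Proof.
have := @measurableT_comp _ _ _ _ _ _ _ _ (fun w : R => X / w) measurable_saw.
by apply; apply: measurable_funM => //; exact: measurable_inv.
Qed.

(** * Integration on bounded half-open intervals *)

Lemma bounded_integrable (A : set R) (f : R -> R) (M : R) :
  measurable A -> (mu A < +oo)%E -> measurable_fun A f ->
  (forall x, A x -> `|f x| <= M) -> mu.-integrable A (EFin \o f).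
Proof.
move=> mA Aoo mf fM; apply: measurable_bounded_integrable => //.
exists M; split; first exact: num_real.
by move=> r Mr x Ax; exact: le_trans (fM _ Ax) (ltW Mr).
Qed.

Lemma itvoc_lty s t : (mu `]s, t] < +oo)%E.
Proof. by rewrite lebesgue_measure_itv/=; case: ifP => // _; rewrite -EFinB ltry. Qed.

Lemma Rintegral_itvoc_cat (f : R -> R) (r s t : R) : r <= s -> s <= t ->
  mu.-integrable `]r, t] (EFin \o f) ->
  \int[mu]_(x in `]r, t]) f x =
  \int[mu]_(x in `]r, s]) f x + \int[mu]_(x in `]s, t]) f x.
Proof.
move=> rs st fi.
by rewrite -(Rintegral_itvB (x := s) fi) ?bnd_simp// addrC subrK.
Qed.

Lemma integrableB_EFin (A : set R) (f g : R -> R) : measurable A ->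
  mu.-integrable A (EFin \o f) -> mu.-integrable A (EFin \o g) ->
  mu.-integrable A (EFin \o (fun x => f x - g x)).
Proof.
move=> mA fi gi; rewrite (_ : _ \o _ = ((EFin \o f) \- (EFin \o g))%E) //.
exact: integrableB.
Qed.

Lemma integrableD_EFin (A : set R) (f g : R -> R) : measurable A ->
  mu.-integrable A (EFin \o f) -> mu.-integrable A (EFin \o g) ->
  mu.-integrable A (EFin \o (fun x => f x + g x)).
Proof.
move=> mA fi gi; rewrite (_ : _ \o _ = ((EFin \o f) \+ (EFin \o g))%E) //.
exact: integrableD.
Qed.

Lemma integrableZl_EFin (A : set R) (k : R) (f : R -> R) : measurable A ->
  mu.-integrable A (EFin \o f) ->
  mu.-integrable A (EFin \o (fun x => k * f x)).
Proof.
move=> mA fi; rewrite (_ : _ \o _ = (fun x => k%:E * (EFin \o f) x)%E) //.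
exact: integrableZl.
Qed.

Lemma is_derive_laurent (a b c d x : R) : x != 0 ->
  is_derive x 1 (fun w : R => a * w^-1 + b + c * w + d * w ^+ 2)
    (- a * x ^- 2 + c + 2 * d * x).
Proof.
move=> x0.
have h : is_derive x (1 : R) (fun w : R => w^-1) (- x ^- 2 *: 1).
  exact: is_deriveV.
apply: is_derive_eq.
rewrite /GRing.scale /=; field.
exact: x0.
Qed.

(** Fundamental theorem of calculus for the family of primitives used below: a quadratic times
    [g0 - Z / w], linear majorants, and multiples of [1 / w]. The constant [b] cancels, but lets a
    product be matched to [G] verbatim. *)
Lemma Rintegral_laurent (a b c d : R) s t : 0 < s -> s <= t ->
  let G w := a * w^-1 + b + c * w + d * w ^+ 2 in
  mu.-integrable `]s, t] (EFin \o (fun w => - a * w ^- 2 + c + 2 * d * w)) /\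
  \int[mu]_(w in `]s, t]) (- a * w ^- 2 + c + 2 * d * w) = G t - G s.
Proof.
move=> s0 st G; set g := fun w : R => _.
have mg A : measurable_fun A g.
  apply: measurable_funTS; apply: measurable_funD => //.
  apply: measurable_funD => //; apply: measurable_funM => //.
  have := @measurableT_comp _ _ _ _ _ _ _ _ (fun x : R => x ^+ 2) measurable_inv.
  by apply; exact: measurable_funX.
have gi : mu.-integrable `]s, t] (EFin \o g).
  apply: (@bounded_integrable _ _ (`|a| * s ^- 2 + `|c| + 2 * `|d| * t)) => //.
    exact: itvoc_lty.
  move=> w /=; rewrite in_itv/= => /andP[sw wt].
  have w0 : 0 < w by exact: lt_trans sw.
  rewrite /g; apply: le_trans (ler_normD _ _) _; apply: lerD; last first.
    rewrite !normrM (ger0_norm (ltW w0)) (ger0_norm (ler0n _ _)).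
    by rewrite ler_wpM2l// mulr_ge0.
  apply: le_trans (ler_normD _ _) _; apply: lerD => //.
  rewrite normrM normrN ler_wpM2l// ger0_norm ?invr_ge0 ?exprn_ge0 ?(ltW w0)//.
  by rewrite lef_pV2 ?posrE ?exprn_gt0// lerXn2r ?nnegrE ?(ltW w0) ?(ltW s0)// ltW.
split=> //.
move: st; rewrite le_eqVlt => /predU1P[->|st].
  by rewrite set_itv_ge ?bnd_simp// Rintegral_set0 subrr.
have dG x : s <= x -> is_derive x 1 G (g x).
  by move=> sx; apply: is_derive_laurent; rewrite gt_eqF// (lt_le_trans s0).
have cG x : s <= x -> {for x, continuous G}.
  move=> sx; apply: differentiable_continuous; apply/derivable1_diffP.
  by have [] := dG _ sx.
have cg x : s <= x -> {for x, continuous g}.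
  move=> sx; have x0 : x != 0 by rewrite gt_eqF// (lt_le_trans s0).
  apply: cvgD; last by apply: cvgM; [exact: cvg_cst|exact: cvg_id].
  apply: cvgD; last exact: cvg_cst.
  apply: cvgM; first exact: cvg_cst.
  apply: cvgV; first by rewrite expf_neq0.
  exact: exprn_continuous.
rewrite Rintegral_itv_obnd_cbnd// /Rintegral (@continuous_FTC2 _ _ G)//.
- apply: continuous_in_subspaceT => x; rewrite inE/= in_itv/= => /andP[sx _].
  exact: cg.
- split.
  + by move=> x; rewrite in_itv/= => /andP[/ltW/dG[]].
  + by apply: cvg_at_right_filter; exact: cG.
  + by apply: cvg_at_left_filter; apply: cG; exact: ltW.
- move=> x; rewrite in_itv/= => /andP[/ltW/dG hx _].
  by rewrite derive1E derive_val.
Qed.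

End Sawtooth.
Arguments saw {R} a.

(** * The iterated kernel *)

Section SawtoothProduct.
Variable R : realType.
Notation mu := (@lebesgue_measure R).
Local Open Scope classical_set_scope.
Implicit Types (s t w Y Z : R) (m k : int).

(** With f the fractional part of t, (f - f^2)/2 is the continuous periodic primitive of [saw] and
    takes values in [0, 1/8]. Substituting t = Y/w and multiplying by -w^2/Y, the inverse of dt/dw,
    gives a function whose derivative inside a cell is [saw (Y / w) + 2 / w * sawP Y w]. *)
Definition sawP Y w : R :=
  - (w ^+ 2 / Y) * ((fracR (Y / w) - fracR (Y / w) ^+ 2) / 2 - 16^-1).

Lemma sawP_norm Y w : 0 < Y -> `|sawP Y w| <= w ^+ 2 / (16 * Y).
Proof.
move=> Y0; rewrite /sawP; set f := fracR _.
have /andP[f0 f1] : 0 <= f < 1 := fracR_itv _ _.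
rewrite normrM normrN (_ : w ^+ 2 / (16 * Y) = w ^+ 2 / Y * 16^-1); last first.
  by field; rewrite gt_eqF.
have wY : 0 <= w ^+ 2 / Y by rewrite divr_ge0 ?sqr_ge0// ltW.
rewrite (ger0_norm wY) ler_wpM2l// ler_norml.
have h1 := sqr_ge0 (f - 2^-1); have h2 : 0 <= f * (1 - f) by rewrite mulr_ge0// subr_ge0 ltW.
by apply/andP; split; nra.
Qed.

(** Since f - f^2 vanishes at both f = 0 and f = 1, [sawP Y] does not jump when Y/w is an integer,
    so one quadratic describes it on the closed cell. Boundary terms of neighbouring cells can
    therefore cancel. *)
Lemma sawPE Y w m : 0 < Y -> 0 < w -> m%:~R <= Y / w <= m%:~R + 1 ->
  sawP Y w = Y / 2 - (1 + 2 * m%:~R) / 2 * w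
             + ((m%:~R + m%:~R ^+ 2) / 2 + 16^-1) / Y * w ^+ 2.
Proof.
move=> Y0 w0 /andP[h1]; rewrite le_eqVlt => /predU1P[h2|h2].
  rewrite /sawP (_ : fracR (Y / w) = 0); last first.
    by rewrite (@fracRE _ _ (m + 1)) ?intrD//; lra.
  have -> : m%:~R = Y / w - 1 by rewrite h2; ring.
  by field; rewrite !gt_eqF.
rewrite /sawP (@fracRE _ _ m) ?h1//.
by field; rewrite !gt_eqF.
Qed.

Definition saw2 Y Z w : R := saw (Y / w) * saw (Z / w).

Lemma saw2_norm Y Z w : `|saw2 Y Z w| <= 4^-1.
Proof.
rewrite normrM (_ : 4^-1 = 2^-1 * 2^-1 :> R); last by field.
by apply: ler_pM => //; exact: saw_norm.
Qed.

Lemma measurable_saw2 Y Z A : measurable_fun A (saw2 Y Z).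
Proof.
by apply: measurable_funTS; apply: measurable_funM; exact: measurable_sawV.
Qed.

Lemma integrable_saw2 Y Z s t : mu.-integrable `]s, t] (EFin \o saw2 Y Z).
Proof.
apply: (@bounded_integrable _ _ _ 4^-1) => //; first exact: itvoc_lty.
- exact: measurable_saw2.
- by move=> w _; exact: saw2_norm.
Qed.

(* Integration by parts: [sawP Y] is, up to lower order terms, a primitive of
   [saw (Y / w)]; the shift by 1/16 in its definition centres the periodic
   factor, which halves its supremum. *)
Lemma saw2_by_parts_cell Y Z s t m k : 0 < Y -> 0 < Z -> 0 < s -> s <= t ->
  m%:~R <= Y / t -> Y / s <= m%:~R + 1 ->
  k%:~R <= Z / t -> Z / s <= k%:~R + 1 ->
  `|\int[mu]_(w in `]s, t]) saw2 Y Z w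
    - (sawP Y t * (2^-1 + k%:~R - Z / t) - sawP Y s * (2^-1 + k%:~R - Z / s))|
  <= ((t ^+ 2 - s ^+ 2) / 2 + Z * (t - s)) / (16 * Y).
Proof.
move=> Y0 Z0 s0 st Yt Ys Zt Zs.
pose g w := 2^-1 + k%:~R - Z / w; rewrite -/(g t) -/(g s).
have t0 : 0 < t by exact: lt_le_trans st.
(* Coefficients of the quadratic that [sawP Y] equals on the cell; [g0 - Z / w] is [saw (Z / w)]
   there, so their product is a Laurent polynomial with explicit derivative. *)
pose c0 := Y / 2. pose c1 := - ((1 + 2 * m%:~R) / 2) : R.
pose c2 := ((m%:~R + m%:~R ^+ 2) / 2 + 16^-1) / Y. pose g0 := 2^-1 + k%:~R : R.
have [iG eG] := @Rintegral_laurent R (- Z * c0) (c0 * g0 - Z * c1)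
  (c1 * g0 - Z * c2) (c2 * g0) s t s0 st.
(* The error integrand will be dominated by (w + Z)/(16 Y), whose integral is exactly the right-hand
   side. *)
have [iE eE] := @Rintegral_laurent R 0 0 (Z / (16 * Y)) (32^-1 / Y) s t s0 st.
have itv X w (j : int) : 0 < X -> s <= w <= t -> j%:~R <= X / t -> X / s <= j%:~R + 1 ->
    j%:~R <= X / w <= j%:~R + 1.
  move=> X0 /andP[sw wt] h1 h2; have w0 : 0 < w by exact: lt_le_trans sw.
  apply/andP; split.
    by apply: le_trans h1 _; rewrite ler_pM2l// lef_pV2.
  by apply: le_trans h2; rewrite ler_pM2l// lef_pV2.
have PE w : s <= w <= t -> sawP Y w = c0 + c1 * w + c2 * w ^+ 2.
  move=> sw; have /andP[sw' _] := sw.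
  rewrite (sawPE Y w m) ?itv// ?(lt_le_trans s0)//.
  by rewrite /c0 /c1 /c2; lra.
have GE w : s <= w <= t -> sawP Y w * g w = - Z * c0 * w^-1 + (c0 * g0 - Z * c1)
    + (c1 * g0 - Z * c2) * w + c2 * g0 * w ^+ 2.
  move=> sw; have /andP[sw' _] := sw.
  by rewrite PE// /g -/g0; field; rewrite gt_eqF// (lt_le_trans s0).
rewrite (GE t) ?st ?lexx// (GE s) ?st ?lexx// -eG.
have iD := @integrableB_EFin R _ _ _ (measurable_itv _) (integrable_saw2 Y Z s t) iG.
rewrite -RintegralB//; last exact: integrable_saw2.
apply: le_trans; first exact: le_normr_Rintegral.
have -> : ((t ^+ 2 - s ^+ 2) / 2 + Z * (t - s)) / (16 * Y) =
  \int[mu]_(w in `]s, t]) (- 0 * w ^- 2 + Z / (16 * Y) + 2 * (32^-1 / Y) * w).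
  by rewrite eE; field; rewrite !gt_eqF.
apply: le_Rintegral => //.
  exact: integrable_norm.
move=> w /=; rewrite in_itv/= => /andP[sw wt].
have w0 : 0 < w by exact: lt_trans sw.
have swt : s <= w <= t by rewrite (ltW sw) wt.
(* As w > s, the upper inequality is strict even if X/s = j + 1, so the fractional part of X/w is
   X/w - j on the whole half-open interval. *)
have lt1 X (j : int) : 0 < X -> X / s <= j%:~R + 1 -> X / w < j%:~R + 1.
  by move=> X0; apply: lt_le_trans; rewrite ltr_pM2l// ltf_pV2.
have sawE X (j : int) : 0 < X -> j%:~R <= X / t -> X / s <= j%:~R + 1 ->
    saw (X / w) = 2^-1 + j%:~R - X / w.
  move=> X0 h1 h2; rewrite /saw (@fracRE _ _ j); first by lra.
  by have /andP[-> _] := itv X w j X0 swt h1 h2; rewrite lt1.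
have gw : `|saw (Z / w)| <= 2^-1 by exact: saw_norm.
have Pw := @sawP_norm Y w Y0.
(* The product rule: the derivative of [sawP Y w * g w] exceeds [saw2 Y Z w] by the term coming from
   the factor w^2 in [sawP] and by the term with g' = Z/w^2. *)
have -> : saw2 Y Z w - (- (- Z * c0) * w ^- 2 + (c1 * g0 - Z * c2) + 2 * (c2 * g0) * w)
   = - (2 / w * sawP Y w * saw (Z / w)) - Z / w ^+ 2 * sawP Y w.
  rewrite PE// /saw2 (sawE _ _ Z0 Zt Zs) (sawE _ _ Y0 Yt Ys) /c0 /c1 /c2 /g0.
  by field; rewrite !gt_eqF.
apply: le_trans (ler_normB _ _) _; rewrite normrN.
have -> : - 0 * w ^- 2 + Z / (16 * Y) + 2 * (32^-1 / Y) * w =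
   2 / w * (w ^+ 2 / (16 * Y)) * 2^-1 + Z / w ^+ 2 * (w ^+ 2 / (16 * Y)).
  by field; rewrite !gt_eqF.
apply: lerD.
  rewrite 2!normrM (ger0_norm (_ : 0 <= 2 / w)) ?divr_ge0 ?(ltW w0)//.
  have w2 : 0 <= 2 / w by rewrite divr_ge0// ltW.
  apply: ler_pM => //; first exact: mulr_ge0.
  exact: ler_wpM2l.
rewrite normrM (ger0_norm (_ : 0 <= Z / _)) ?divr_ge0 ?sqr_ge0 ?(ltW Z0)//.
by rewrite ler_wpM2l// divr_ge0 ?sqr_ge0// ltW.
Qed.

(** Y/w may now cross integers: cut the interval at the points where it does. The boundary terms
    telescope because [sawP Y] is continuous, and the error bound is additive over intervals. Z/w
    stays in one cell, because [saw (Z / w)] does jump. *)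
Lemma saw2_by_parts Y Z s t k : 0 < Y -> 0 < Z -> 0 < s -> s <= t ->
  k%:~R <= Z / t -> Z / s <= k%:~R + 1 ->
  `|\int[mu]_(w in `]s, t]) saw2 Y Z w
    - (sawP Y t * (2^-1 + k%:~R - Z / t) - sawP Y s * (2^-1 + k%:~R - Z / s))|
  <= ((t ^+ 2 - s ^+ 2) / 2 + Z * (t - s)) / (16 * Y).
Proof.
move=> Y0 Z0 s0 + + Zs.
pose g w := 2^-1 + k%:~R - Z / w; rewrite -/(g s).
(* The induction variable bounds the number of integers between Y/t and Y/s; any integer above Y/s
   serves. *)
have [j jP] : exists j : nat, s <= t -> Y / s <= (Num.floor (Y / t))%:~R + 1 + j%:R.
  exists (Num.bound (Y / s)) => st; have t0 : 0 < t by exact: lt_le_trans st.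
  apply: le_trans (_ : (Num.bound (Y / s))%:R <= _).
    by rewrite ltW// archi_boundP// divr_ge0// ltW.
  rewrite lerDr addr_ge0// ler0z floor_ge0 divr_ge0// ltW//.
elim: j t jP => [|j IH] t + st Zt => /(_ st) jP; rewrite -/(g t).
  apply: (@saw2_by_parts_cell Y Z s t (Num.floor (Y / t)) k) => //.
    by have /andP[] := floor_itv (Y / t).
  by rewrite addr0 in jP.
set m := Num.floor (Y / t) in jP.
have t0 : 0 < t by exact: lt_le_trans st.
have /andP[mt] := floor_itv (Y / t); rewrite -/m in mt *.
rewrite intrD => tm.
have [Ysm|msY] := leP (Y / s) (m%:~R + 1).
  exact: (@saw2_by_parts_cell Y Z s t m k).
have m0 : 0 <= m%:~R :> R.
  by rewrite ler0z floor_ge0 divr_ge0// ltW.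
have m1 : 0 < m%:~R + 1 :> R by exact: ltr_wpDl.
(* The cut closest to t: Y/r is the first integer above Y/t. Thus ]r, t] is one cell, and ]s, r] has
   one crossing fewer. *)
pose r := Y / (m%:~R + 1).
have r0 : 0 < r by rewrite divr_gt0.
have rt : r < t by rewrite ltr_pdivrMr// mulrC -ltr_pdivrMr.
have sr : s <= r by rewrite ler_pdivlMr// mulrC -ler_pdivlMr// ltW.
have Yr : Y / r = m%:~R + 1 by rewrite /r invf_div mulrC divfK// gt_eqF.
have fr : Num.floor (Y / r) = m + 1.
  by apply: floor_def; rewrite Yr !intrD lexx/= ltrDl.
have Zr : k%:~R <= Z / r.
  by apply: le_trans Zt _; rewrite ler_pM2l// lef_pV2// ltW.
have h1 := IH r.
rewrite fr intrD -/(g r) in h1.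
have {}h1 : `|\int[mu]_(w in `]s, r]) saw2 Y Z w - (sawP Y r * g r - sawP Y s * g s)|
  <= ((r ^+ 2 - s ^+ 2) / 2 + Z * (r - s)) / (16 * Y).
  by apply: h1 => // _; rewrite (le_trans jP)// -natr1; lra.
have h2 : `|\int[mu]_(w in `]r, t]) saw2 Y Z w - (sawP Y t * g t - sawP Y r * g r)|
  <= ((t ^+ 2 - r ^+ 2) / 2 + Z * (t - r)) / (16 * Y).
  apply: (@saw2_by_parts_cell Y Z r t m k) => //; first exact: ltW.
    by rewrite Yr.
  by apply: le_trans Zs; rewrite ler_pM2l// lef_pV2.
rewrite (@Rintegral_itvoc_cat _ _ s r t)//; [|exact: ltW|exact: integrable_saw2].
have -> : ((t ^+ 2 - s ^+ 2) / 2 + Z * (t - s)) / (16 * Y) =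
 ((r ^+ 2 - s ^+ 2) / 2 + Z * (r - s)) / (16 * Y)
 + ((t ^+ 2 - r ^+ 2) / 2 + Z * (t - r)) / (16 * Y).
  by rewrite -mulrDl; congr (_ * _); lra.
move: h1 h2; rewrite !ler_norml => /andP[? ?] /andP[? ?].
by apply/andP; split; lra.
Qed.

(** Each boundary term is at most w^2/(32 Y), its second factor lying in [-1/2, 1/2]. Added to the
    error term, the two s^2 contributions cancel and t^2 remains. *)
Lemma saw2_cell Y Z s t k : 0 < Y -> 0 < Z -> 0 < s -> s <= t ->
  k%:~R <= Z / t -> Z / s <= k%:~R + 1 ->
  `|\int[mu]_(w in `]s, t]) saw2 Y Z w| <= (t ^+ 2 + Z * (t - s)) / (16 * Y).
Proof.
move=> Y0 Z0 s0 st Zt Zs; have := @saw2_by_parts Y Z s t k Y0 Z0 s0 st Zt Zs.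
have t0 : 0 < t by exact: lt_le_trans st.
have Zst : Z / t <= Z / s by rewrite ler_pM2l// lef_pV2.
set gt := _ - Z / t; set gs := _ - Z / s => h.
have ht : `|sawP Y t * gt| <= t ^+ 2 / (16 * Y) * 2^-1.
  rewrite normrM; apply: ler_pM => //; first exact: sawP_norm.
  by rewrite /gt ler_norml; lra.
have hs : `|sawP Y s * gs| <= s ^+ 2 / (16 * Y) * 2^-1.
  rewrite normrM; apply: ler_pM => //; first exact: sawP_norm.
  by rewrite /gs ler_norml; lra.
have -> : (t ^+ 2 + Z * (t - s)) / (16 * Y) = ((t ^+ 2 - s ^+ 2) / 2 + Z * (t - s)) / (16 * Y) +
   t ^+ 2 / (16 * Y) * 2^-1 + s ^+ 2 / (16 * Y) * 2^-1.
  by field; rewrite gt_eqF.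
move: h ht hs; rewrite !ler_norml => /andP[? ?] /andP[? ?] /andP[? ?].
by apply/andP; split; lra.
Qed.

(** The interval is cut at the points Z/n where Z/w crosses an integer; the rightmost cell ends at
    1. The squares of the other right endpoints, Z^2/n^2, are summed by the telescoping bound 1/n^2
    <= 1/(n - 1/2) - 1/(n + 1/2). *)
Lemma saw2_tail Y Z (k N : nat) :
  0 < Y -> 1 <= Z -> k%:R <= Z -> Z <= k%:R + 1 ->
  `|\int[mu]_(w in `]Z / (k + N).+1%:R, 1]) saw2 Y Z w| <=
  (1 + Z * (1 - Z / (k + N).+1%:R)
   + Z ^+ 2 * ((k%:R + 2^-1)^-1 - ((k + N)%:R + 2^-1)^-1)) / (16 * Y).
Proof.
move=> Y0 Z1 kZ Zk; have Z0 : 0 < Z by exact: lt_le_trans Z1.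
elim: N => [|N IH].
  rewrite addn0 subrr mulr0 addr0 -natr1.
  have k1 : 0 < k%:R + 1 :> R by rewrite natr1.
  have := @saw2_cell Y Z (Z / (k%:R + 1)) 1 (Posz k) Y0 Z0; rewrite expr1n; apply.
  - by rewrite divr_gt0.
  - by rewrite ler_pdivrMr// mul1r.
  - by rewrite divr1.
  - by rewrite invf_div mulrC divfK// gt_eqF.
rewrite addnS; set n := (k + N)%N in IH *.
have n0 : 0 <= n%:R :> R by rewrite ler0n.
have n1 : 0 < n.+1%:R :> R by rewrite ltr0n.
have n2 : 0 < n.+2%:R :> R by rewrite ltr0n.
have Zn2 : 0 < Z / n.+2%:R by rewrite divr_gt0.
have Zn : Z / n.+2%:R <= Z / n.+1%:R by rewrite ler_pM2l// lef_pV2// ler_nat.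
have kn : k%:R <= n%:R :> R by rewrite ler_nat leq_addr.
have Zn1 : Z / n.+1%:R <= 1.
  by rewrite ler_pdivrMr// mul1r -natr1 (le_trans Zk)// lerD2r.
rewrite (@Rintegral_itvoc_cat _ _ _ _ _ Zn Zn1); last exact: integrable_saw2.
have h := @saw2_cell Y Z (Z / n.+2%:R) (Z / n.+1%:R) (Posz n.+1) Y0 Z0 Zn2 Zn.
have {h} := h _ _.
rewrite !invf_div ![Z * (_ / Z)]mulrC !divfK ?gt_eqF// => /(_ (lexx _)).
rewrite -pmulrn natr1 => /(_ (lexx _)) h.
apply: le_trans (ler_normD _ _) _; apply: le_trans (lerD h IH) _.
rewrite -mulrDl ler_pM2r ?invr_gt0 ?mulr_gt0//.
have -> : (Z / n.+1%:R) ^+ 2 = Z ^+ 2 * n.+1%:R ^- 2 by rewrite exprMn exprVn.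
have q : n.+1%:R ^- 2 <= (n%:R + 2^-1)^-1 - (n.+1%:R + 2^-1)^-1 :> R.
  have -> : (n%:R + 2^-1)^-1 - (n.+1%:R + 2^-1)^-1 =
    ((n%:R + 2^-1) * (n.+1%:R + 2^-1))^-1 :> R.
    by rewrite -(natr1 n); field; rewrite !gt_eqF//; lra.
  have p1 : 0 < n%:R + 2^-1 :> R by lra.
  have p2 : 0 < n.+1%:R + 2^-1 :> R by lra.
  rewrite lef_pV2 ?posrE ?exprn_gt0 ?mulr_gt0//.
  by rewrite -(natr1 n); nra.
have : Z ^+ 2 * n.+1%:R ^- 2 <= Z ^+ 2 * ((n%:R + 2^-1)^-1 - (n.+1%:R + 2^-1)^-1).
  by rewrite ler_wpM2l// sqr_ge0.
move: (n.+1%:R ^- 2) (n.+1%:R^-1) (n.+2%:R^-1) ((n%:R + 2^-1)^-1)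
  ((n.+1%:R + 2^-1)^-1) ((k%:R + 2^-1)^-1) => *.
by lra.
Qed.

Lemma saw2_head Y Z (r : R) : 0 <= r ->
  `|\int[mu]_(w in `]0, r]) saw2 Y Z w| <= r / 4.
Proof.
move=> r0; apply: le_trans.
  by apply: le_normr_Rintegral => //; exact: integrable_saw2.
have -> : r / 4 = \int[mu]_(w in `]0, r]) (4^-1).
  rewrite Rintegral_cst//= lebesgue_measure_itv/= lte_fin.
  move: r0; rewrite le_eqVlt => /predU1P[<-|->]; first by rewrite ltxx mul0r mulr0.
  by rewrite -EFinB/= subr0 mulrC.
apply: le_Rintegral => //.
- by apply: integrable_norm; exact: integrable_saw2.
- apply: (@bounded_integrable _ _ _ 4^-1); [by []|exact: itvoc_lty|by []|].
  by move=> w _; rewrite ger0_norm.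
- by move=> w _; exact: saw2_norm.
Qed.

(** Cells exhaust ]0, 1] up to a remainder ]0, r] with r <= e, where the trivial bound 1/4 on the
    integrand suffices. The cells contribute at most (1 + Z + (Z + 1))/(16 Y), whatever their
    number. *)
Lemma saw2_bound Y Z : 0 < Y -> 1 <= Z ->
  `|\int[mu]_(w in `]0, 1]) saw2 Y Z w| <= (1 + Z) / (8 * Y).
Proof.
move=> Y0 Z1; have Z0 : 0 < Z by exact: lt_le_trans Z1.
have /andP[kZ Zk] := truncn_itv (ltW Z0).
set k := Num.trunc Z in kZ Zk.
apply/ler_addgt0Pr => e e0.
pose N := Num.bound (Z / e).
have Ne : Z / (k + N).+1%:R <= e.
  rewrite ler_pdivrMr ?ltr0n// mulrC -ler_pdivrMr//.
  apply: le_trans (ltW (archi_boundP _)) _; first by rewrite divr_ge0// ltW.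
  by rewrite ler_nat leqW// leq_addl.
have h1 := @saw2_tail Y Z k N Y0 Z1 kZ _.
have {}h1 := h1 _; rewrite natr1 in h1; have {}h1 := h1 (ltW Zk).
set r := Z / _ in Ne h1.
have r0 : 0 <= r by rewrite divr_ge0// ltW.
have r1 : r <= 1.
  rewrite ler_pdivrMr ?ltr0n// mul1r (le_trans (ltW Zk))// ler_nat.
  by rewrite ltnS leq_addr.
rewrite (@Rintegral_itvoc_cat _ _ _ _ _ r0 r1); last exact: integrable_saw2.
apply: le_trans (ler_normD _ _) _.
have h2 := @saw2_head Y Z r r0.
suff : (1 + Z * (1 - r) + Z ^+ 2 * ((k%:R + 2^-1)^-1 - ((k + N)%:R + 2^-1)^-1)) / (16 * Y)
  <= (1 + Z) / (8 * Y) by lra.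
have -> : (1 + Z) / (8 * Y) = (2 + 2 * Z) / (16 * Y) by field; rewrite gt_eqF.
rewrite ler_pM2r ?invr_gt0 ?mulr_gt0//.
have q1 : 0 <= Z * r by rewrite mulr_ge0// ltW.
have q2 : 0 <= Z ^+ 2 * ((k + N)%:R + 2^-1)^-1.
  by rewrite mulr_ge0 ?sqr_ge0// invr_ge0 addr_ge0.
(* From Z <= k + 1 one has k + 1/2 >= Z - 1/2, and (Z + 1)(Z - 1/2) >= Z^2 because Z >= 1. *)
have q3 : Z ^+ 2 * (k%:R + 2^-1)^-1 <= Z + 1.
  rewrite -natr1 in Zk.
  rewrite ler_pdivrMr; last by lra.
  nra.
by lra.
Qed.

End SawtoothProduct.
Arguments saw2 {R} Y Z w.

(** * Fubini's theorem and the eigenvalue equation *)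

Section RintegralFubini.
Variable R : realType.
Notation mu := (@lebesgue_measure R).
Local Open Scope classical_set_scope.

Lemma EFin_Rintegral (A : set R) (f : R -> R) : measurable A ->
  mu.-integrable A (EFin \o f) ->
  (\int[mu]_(x in A) (f x)%:E = (\int[mu]_(x in A) f x)%R%:E)%E.
Proof.
by move=> mA fi; rewrite /Rintegral fineK//; exact: integrable_fin_num.
Qed.

Lemma measurable_section1 (F : R -> R -> R) (x : R) :
  measurable_fun setT (fun p : R * R => F p.1 p.2) -> measurable_fun setT (F x).
Proof.
move=> mF; have := @measurableT_comp _ _ _ _ _ _ _ _ (pair x) mF.
by apply; exact: measurable_pair1.
Qed.

Lemma measurable_section2 (F : R -> R -> R) (y : R) :
  measurable_fun setT (fun p : R * R => F p.1 p.2) -> measurable_fun setT (F ^~ y).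
Proof.
move=> mF; have := @measurableT_comp _ _ _ _ _ _ _ _ (pair ^~ y) mF.
by apply; exact: measurable_pair2.
Qed.

(** A bounded function on a square of finite measure is integrable; extending it by 0 off [A]*[A]
    reduces the claim to Fubini on the plane. Measurability of the inner integral is kept because
    the iterated kernel times [phi] has to be integrated later. *)
Lemma Rintegral_fubini (A : set R) (F : R -> R -> R) (M : R) :
  measurable A -> (mu A < +oo)%E ->
  measurable_fun setT (fun p : R * R => F p.1 p.2) ->
  (forall x y, A x -> A y -> `|F x y| <= M) ->
  measurable_fun A (fun y => \int[mu]_(x in A) F x y) /\
  \int[mu]_(x in A) \int[mu]_(y in A) F x y =
  \int[mu]_(y in A) \int[mu]_(x in A) F x y.
Proof.
move=> mA Aoo mF FM.
have i1 x : A x -> mu.-integrable A (EFin \o F x).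
  move=> Ax; apply: (@bounded_integrable _ _ _ M) => //; last by move=> y; exact: FM.
  by apply: measurable_funTS; exact: measurable_section1.
have i2 y : A y -> mu.-integrable A (EFin \o F ^~ y).
  move=> Ay; apply: (@bounded_integrable _ _ _ M) => //; last by move=> x Ax; exact: FM.
  by apply: measurable_funTS; exact: measurable_section2.
pose G := ((fun p : R * R => (F p.1 p.2)%:E) \_ (A `*` A)).
have mAA : measurable (A `*` A) by exact: measurableX.
have iG : (mu \x mu)%E.-integrable setT G.
  have [+ _] := @integrable_mkcond _ _ _ (mu \x mu)%E (A `*` A)
    (fun p : R * R => (F p.1 p.2)%:E) mAA.
  apply; have := @measurable_bounded_integrable _ _ _ (mu \x mu)%E
    (fun p : R * R => F p.1 p.2) (A `*` A) mAA; apply.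
  - suff : (mu A * mu A < +oo)%E by rewrite -product_measure1E.
    by rewrite lte_mul_pinfty// ge0_fin_numE.
  - exact: measurable_funTS.
  - exists M; split; first exact: num_real.
    by move=> r Mr [x y] [Ax Ay]; exact: le_trans (FM _ _ Ax Ay) (ltW Mr).
have := @Fubini _ _ _ _ _ mu mu G iG.
have -> : (\int[mu]_x \int[mu]_y G (x, y) =
    \int[mu]_(x in A) (\int[mu]_(y in A) F x y)%R%:E)%E.
  rewrite [RHS]integral_mkcond; apply: eq_integral => x _.
  rewrite patchE; case: ifPn => [|xA]; last first.
    apply: integral0_eq => y _; rewrite /G patchE; case: ifPn => //.
    by rewrite inE => -[/mem_set]; rewrite (negbTE xA).
  rewrite inE => Ax; rewrite -EFin_Rintegral//; last exact: i1.
  rewrite [RHS]integral_mkcond; apply: eq_integral => y _; rewrite /G !patchE.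
  have -> : ((x, y) \in A `*` A) = (y \in A).
    by apply/idP/idP; rewrite !inE => //= -[].
  by [].
have GE : (fun y => \int[mu]_x G (x, y))%E =
    (fun y => (\int[mu]_(x in A) F x y)%R%:E) \_ A.
  apply/funext => y; rewrite patchE; case: ifPn => [|yA]; last first.
    apply: integral0_eq => x _; rewrite /G patchE; case: ifPn => //.
    by rewrite inE => -[_ /mem_set]; rewrite (negbTE yA).
  rewrite inE => Ay; rewrite -EFin_Rintegral//; last exact: i2.
  rewrite [RHS]integral_mkcond; apply: eq_integral => x _; rewrite /G !patchE.
  have -> : ((x, y) \in A `*` A) = (x \in A).
    by apply/idP/idP; rewrite !inE => //= -[].
  by [].
rewrite GE -integral_mkcond => E; split; last by rewrite /Rintegral E.
apply/measurable_EFinP; apply/measurable_restrictT => //.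
by rewrite (_ : _ \_ _ = fubini_G mu G); [exact: (measurable_fubini_G iG)|rewrite -GE].
Qed.

End RintegralFubini.

(** * Supremum bound, eigenvalue bound and the iterated equation *)

Section Eigenfunction.
Variable R : realType.
Notation mu := (@lebesgue_measure R).
Local Open Scope classical_set_scope.
Variables (phi : R -> R) (lam : R).
Hypothesis phiE : eigenfun phi lam.
Hypothesis phi1 : inner01 phi phi = 1.
Let L := `|lam|.
(** Leaving out the null point 0 avoids the place where [Kker] is 0 by convention and differs from
    the sawtooth formula. *)
Local Notation J := (`]0%R, 1%R] : set R).

Lemma J_lty : (mu J < +oo)%E. Proof. exact: itvoc_lty. Qed.

Lemma sub_J01 : J `<=` @I01 R.
Proof. by move=> x; rewrite /I01/= !in_itv/= => /andP[/ltW -> ->]. Qed.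

Lemma Kker_saw (x y : R) : 0 < x -> 0 < y -> Kker x y = saw (x^-1 / y).
Proof. by move=> x0 y0; rewrite /Kker mulf_eq0 !gt_eqF//= invfM. Qed.

Lemma measurable_phi : measurable_fun J phi.
Proof.
case: phiE => -[mphi _] _; apply: (measurable_funS _ _ mphi).
- exact: measurable_itv.
- exact: sub_J01.
Qed.

Lemma integrable_phi2 : mu.-integrable J (EFin \o (fun x => phi x ^+ 2)).
Proof.
case: phiE => -[mphi phioo] _; apply: (@integrableS _ _ _ mu (@I01 R)).
- exact: measurable_itv.
- exact: measurable_itv.
- exact: sub_J01.
apply/integrableP; split; first exact/measurable_EFinP/measurable_funX.
by under eq_integral do rewrite /= ger0_norm ?sqr_ge0//.
Qed.

Lemma Rintegral_phi2 : \int[mu]_(x in J) phi x ^+ 2 = 1.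
Proof.
have i2 : mu.-integrable J (EFin \o (fun x => phi x * phi x)).
  exact: integrable_phi2.
rewrite -[RHS]phi1 /inner01 /I01 -(Rintegral_itv_obnd_cbnd i2).
by apply: eq_Rintegral => x _; rewrite expr2.
Qed.

(** Cauchy-Schwarz in weighted form: expand (c k + phi)^2 >= 0 and (c k - phi)^2 >= 0 and divide by
    c. Each use picks its own weight c, and the same pointwise bound yields integrability of the
    product. *)
Lemma Rintegral_amgm (A : set R) (k : R -> R) (c : R) : measurable A -> A `<=` J -> 0 < c ->
  measurable_fun A k -> mu.-integrable A (EFin \o (fun x => k x ^+ 2)) ->
  mu.-integrable A (EFin \o (fun x => k x * phi x)) /\
  \int[mu]_(x in A) `|k x * phi x| <=
    (c * \int[mu]_(x in A) k x ^+ 2 + c^-1 * \int[mu]_(x in A) phi x ^+ 2) / 2.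
Proof.
move=> mA AJ c0 mk ik.
have iphi : mu.-integrable A (EFin \o (fun x => phi x ^+ 2)).
  by apply: integrableS integrable_phi2.
have i1 := @integrableZl_EFin R A c _ mA ik.
have i2 := @integrableZl_EFin R A c^-1 _ mA iphi.
have i3 := @integrableZl_EFin R A 2^-1 _ mA (@integrableD_EFin R A _ _ mA i1 i2).
have amgm x : `|k x * phi x| <= 2^-1 * (c * k x ^+ 2 + c^-1 * phi x ^+ 2).
  rewrite ler_norml; apply/andP; split.
    have : 0 <= c^-1 * (c * k x + phi x) ^+ 2 by rewrite mulr_ge0 ?sqr_ge0// invr_ge0 ltW.
    have -> : c^-1 * (c * k x + phi x) ^+ 2 = c * k x ^+ 2 + c^-1 * phi x ^+ 2 + 2 * (k x * phi x).
      by field; rewrite gt_eqF.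
    by lra.
  have : 0 <= c^-1 * (c * k x - phi x) ^+ 2 by rewrite mulr_ge0 ?sqr_ge0// invr_ge0 ltW.
  have -> : c^-1 * (c * k x - phi x) ^+ 2 = c * k x ^+ 2 + c^-1 * phi x ^+ 2 - 2 * (k x * phi x).
    by field; rewrite gt_eqF.
  by lra.
have ikphi : mu.-integrable A (EFin \o (fun x => k x * phi x)).
  apply: (@le_integrable _ _ _ mu A _ _
    (EFin \o (fun x => 2^-1 * (c * k x ^+ 2 + c^-1 * phi x ^+ 2)))).
  - by [].
  - apply/measurable_EFinP/measurable_funM => //.
    exact: measurable_funS measurable_phi.
  - by move=> x Ax /=; rewrite lee_fin; apply: le_trans (amgm x) (ler_norm _).
  - exact: i3.
split => //.
rewrite -RintegralZl// -[X in _ + X]RintegralZl// -RintegralD// mulrC -RintegralZl//; last first.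
  exact: (@integrableD_EFin R A _ _ mA i1 i2).
apply: le_Rintegral => //; exact: integrable_norm.
Qed.

Lemma integrable_saw_sqr (X : R) :
  mu.-integrable J (EFin \o (fun y => saw (X / y) ^+ 2)) /\
  \int[mu]_(y in J) saw (X / y) ^+ 2 <= 4^-1.
Proof.
have le4 y : `|saw (X / y) ^+ 2| <= 4^-1.
  rewrite normrX (_ : 4^-1 = 2^-1 ^+ 2); last by field.
  by rewrite lerXn2r ?nnegrE// saw_norm.
have ii : mu.-integrable J (EFin \o (fun y => saw (X / y) ^+ 2)).
  apply: (@bounded_integrable _ _ _ 4^-1) => //; first exact: J_lty.
  by apply: measurable_funTS; apply: measurable_funX; exact: measurable_sawV.
split => //.
have -> : 4^-1 = \int[mu]_(y in J) (4^-1).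
  by rewrite Rintegral_cst//= lebesgue_measure_itv/= lte_fin ltr01 -EFinB/= subr0 mulr1.
apply: le_Rintegral => //.
  apply: (@bounded_integrable _ _ _ 4^-1); [by []|exact: J_lty|by []|].
  by move=> y _; rewrite ger0_norm.
by move=> y _; apply: le_trans (ler_norm _) (le4 y).
Qed.

Lemma Rintegral_saw_phi (X : R) :
  mu.-integrable J (EFin \o (fun y => saw (X / y) * phi y)) /\
  `|\int[mu]_(y in J) (saw (X / y) * phi y)| <= 2^-1.
Proof.
have [i2 h2] := integrable_saw_sqr X.
(* With 1/4 bounding the integral of the squared sawtooth and [phi] of norm 1, weight 2 gives (2/4 +
   1/2)/2 = 1/2. *)
have [ii hi] := @Rintegral_amgm J (fun y => saw (X / y)) 2
  (measurable_itv _) (@subset_refl _ _) (ltr0n _ 2)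
  (measurable_funTS (measurable_sawV R X)) i2.
split => //; apply: le_trans; first exact: le_normr_Rintegral.
by apply: le_trans hi _; rewrite Rintegral_phi2; lra.
Qed.

Lemma eigenfun_saw (x : R) : 0 < x -> x <= 1 ->
  phi x = lam * \int[mu]_(y in J) (saw (x^-1 / y) * phi y).
Proof.
move=> x0 x1; case: phiE => _ [_ /(_ x)] ->; last first.
  by rewrite inE/= /I01/= in_itv/= (ltW x0).
have KE y : J y -> Kker x y * phi y = saw (x^-1 / y) * phi y.
  by rewrite /= in_itv/= => /andP[y0 _]; rewrite Kker_saw.
congr (_ * _).
have iK : mu.-integrable J (EFin \o (fun y => Kker x y * phi y)).
  have [+ _] := Rintegral_saw_phi x^-1; apply: eq_integrable => // y.
  by rewrite inE => Jy; rewrite /= KE.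
rewrite /I01 -(Rintegral_itv_obnd_cbnd iK).
by apply: eq_Rintegral => y; rewrite inE => /KE.
Qed.

Lemma eigenfun_sup (x : R) : 0 < x -> x <= 1 -> `|phi x| <= L / 2.
Proof.
move=> x0 x1; rewrite eigenfun_saw// normrM ler_wpM2l//.
by have [_] := Rintegral_saw_phi x^-1.
Qed.

(** By normalisation and the supremum bound, 1 is at most (L/2)^2. *)
Lemma eigenvalue_ge2 : 2 <= L.
Proof.
have : \int[mu]_(x in J) phi x ^+ 2 <= \int[mu]_(x in J) (L / 2) ^+ 2.
  apply: le_Rintegral => //; first exact: integrable_phi2.
    apply: (@bounded_integrable _ _ _ ((L / 2) ^+ 2)); [by []|exact: J_lty|by []|].
    by move=> y _; rewrite ger0_norm// sqr_ge0.
  move=> x /=; rewrite in_itv/= => /andP[x0 x1].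
  rewrite -real_normK ?num_real// lerXn2r ?nnegrE ?divr_ge0 ?normr_ge0//.
  exact: eigenfun_sup.
rewrite Rintegral_phi2 Rintegral_cst//= lebesgue_measure_itv/= lte_fin ltr01 -EFinB/= subr0 mulr1.
have : 0 <= L by exact: normr_ge0.
by nra.
Qed.

(** The iterated kernel K2(y, z). *)
Definition saw2I (y z : R) : R := \int[mu]_(w in J) saw2 y^-1 z^-1 w.

Lemma eigenfun_iterated (y : R) : 0 < y -> y <= 1 ->
  measurable_fun J (fun z => saw2I y z * phi z) /\
  phi y = lam ^+ 2 * \int[mu]_(z in J) (saw2I y z * phi z).
Proof.
move=> y0 y1.
(* [phi] is known to be measurable on the interval only, while Fubini asks for measurability on the
   plane; hence the extension by 0. *)
pose psi := phi \_ J.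
pose F w z := saw (y^-1 / w) * saw (w^-1 / z) * psi z.
have psiE z : J z -> psi z = phi z by move=> Jz; rewrite /psi patchE mem_set.
have mF : measurable_fun setT (fun p : R * R => F p.1 p.2).
  have h1 : measurable_fun setT (fun p : R * R => saw (y^-1 / p.1)).
    have := @measurableT_comp _ _ _ _ _ _ _ _ (fun p : R * R => p.1) (measurable_sawV R y^-1).
    by apply; exact: measurable_fst.
  have h2 : measurable_fun setT (fun p : R * R => psi p.2).
    have mpsi : measurable_fun setT psi.
      have [+ _] := @measurable_restrictT _ _ _ _ J phi (measurable_itv _).
      by apply; exact measurable_phi.
    have := @measurableT_comp _ _ _ _ _ _ _ _ (fun p : R * R => p.2) mpsi.
    by apply; exact: measurable_snd.
  have h3 : measurable_fun setT (fun p : R * R => saw (p.1^-1 / p.2)).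
    have := @measurableT_comp _ _ _ _ _ _ _ _ (fun p : R * R => p.1^-1 / p.2) (@measurable_saw R).
    apply; apply: measurable_funM.
      have := @measurableT_comp _ _ _ _ _ _ _ _ (fun p : R * R => p.1) (@measurable_inv R).
      by apply; exact: measurable_fst.
    have := @measurableT_comp _ _ _ _ _ _ _ _ (fun p : R * R => p.2) (@measurable_inv R).
    by apply; exact: measurable_snd.
  by apply: measurable_funM => //; exact: measurable_funM.
have FM w z : J w -> J z -> `|F w z| <= 4^-1 * (L / 2).
  move=> Jw Jz; rewrite /F normrM; apply: ler_pM => //.
    rewrite normrM (_ : 4^-1 = 2^-1 * 2^-1 :> R); last by field.
    by apply: ler_pM => //; exact: saw_norm.
  by rewrite psiE//; move: Jz => /=; rewrite in_itv/= => /andP[z0 z1]; exact: eigenfun_sup.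
have [mG FE] := @Rintegral_fubini _ _ _ _ (measurable_itv _) J_lty mF FM.
have GE z : J z -> \int[mu]_(w in J) F w z = saw2I y z * phi z.
  move=> Jz; rewrite /saw2I -RintegralZr//; last exact: integrable_saw2.
  apply: eq_Rintegral => w _; rewrite /F psiE// /saw2.
  by congr (_ * saw _ * _); rewrite mulrC.
split.
  apply: eq_measurable_fun mG => z; rewrite inE => Jz; exact: GE.
have lam0 : lam != 0 by rewrite -normr_gt0; exact: (lt_le_trans (ltr0n _ 2) eigenvalue_ge2).
(* The eigenvalue equation at w, solved for the inner integral and multiplied by [saw (y^-1 / w)];
   the remaining integral over w is the equation at y. *)
have HE w : J w -> \int[mu]_(z in J) F w z = lam^-1 * (saw (y^-1 / w) * phi w).
  move=> Jw; have /andP[w0 w1] : 0 < w <= 1 by move: Jw => /=; rewrite in_itv.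
  rewrite eigenfun_saw// (mulrCA lam^-1) mulKf//.
  have [iw _] := Rintegral_saw_phi w^-1.
  rewrite -RintegralZl//; apply: eq_Rintegral => z; rewrite inE => Jz.
  by rewrite /F psiE// mulrA.
have [iy _] := Rintegral_saw_phi y^-1.
have -> : \int[mu]_(z in J) (saw2I y z * phi z) =
    lam^-1 * \int[mu]_(w in J) (saw (y^-1 / w) * phi w).
  rewrite -RintegralZl//.
  transitivity (\int[mu]_(z in J) \int[mu]_(w in J) F w z).
    by apply: eq_Rintegral => z; rewrite inE => /GE.
  by rewrite -FE; apply: eq_Rintegral => w; rewrite inE => /HE.
rewrite {1}eigenfun_saw//; field; exact: lam0.
Qed.

End Eigenfunction.
Arguments saw2I {R} y z.

(** * Decay of eigenfunctions at the origin *)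

Section Decay.
Variable R : realType.
Notation mu := (@lebesgue_measure R).
Local Open Scope classical_set_scope.
Local Notation J := (`]0%R, 1%R] : set R).

Lemma Rintegral_invsq (r s t : R) : 0 < s -> s <= t ->
  mu.-integrable `]s, t] (EFin \o (fun w => (r * w^-1) ^+ 2)) /\
  \int[mu]_(w in `]s, t]) (r * w^-1) ^+ 2 = r ^+ 2 * (s^-1 - t^-1).
Proof.
move=> s0 st.
have [+ +] := @Rintegral_laurent R (- r ^+ 2) 0 0 0 s t s0 st.
have -> : (fun w : R => - - r ^+ 2 * w ^- 2 + 0 + 2 * 0 * w) = (fun w => (r * w^-1) ^+ 2).
  by apply/funext => w; rewrite exprMn exprVn opprK addr0 mulr0 mul0r addr0.
by move=> i ->; split => //; ring.
Qed.

Lemma Rintegral_invsqrt (s t : R) : 0 < s -> s <= t ->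
  mu.-integrable `]s, t] (EFin \o (fun w => (Num.sqrt w)^-1)) /\
  \int[mu]_(w in `]s, t]) (Num.sqrt w)^-1 = 2 * Num.sqrt t - 2 * Num.sqrt s.
Proof.
move=> s0 st; set g := (fun w : R => (Num.sqrt w)^-1).
have mg A : measurable_fun A g.
  apply: measurable_funTS.
  have := @measurableT_comp _ _ _ _ _ _ _ _ (@Num.sqrt R) (@measurable_inv R).
  by apply; apply: continuous_measurable_fun; exact: sqrt_continuous.
have gi : mu.-integrable `]s, t] (EFin \o g).
  apply: (@bounded_integrable _ _ _ (Num.sqrt s)^-1) => //.
    exact: itvoc_lty.
  move=> w /=; rewrite in_itv/= => /andP[sw wt].
  have w0 : 0 < w by exact: lt_trans sw.
  rewrite /g ger0_norm ?invr_ge0 ?sqrtr_ge0//.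
  by rewrite lef_pV2 ?posrE ?sqrtr_gt0// ler_wsqrtr// ltW.
split=> //.
move: st; rewrite le_eqVlt => /predU1P[->|st].
  by rewrite set_itv_ge ?bnd_simp// Rintegral_set0 subrr.
pose G w : R := 2 * Num.sqrt w.
have dG x : s <= x -> is_derive x 1 G (g x).
  move=> sx; have x0 : 0 < x by exact: lt_le_trans sx.
  have dx := is_derive1_sqrt x0.
  apply: is_derive_eq; rewrite /g /GRing.scale/=; field.
  by rewrite gt_eqF// sqrtr_gt0.
have cG x : s <= x -> {for x, continuous G}.
  move=> sx; apply: differentiable_continuous; apply/derivable1_diffP.
  by have [] := dG _ sx.
rewrite Rintegral_itv_obnd_cbnd// /Rintegral (@continuous_FTC2 _ _ G)//.
- apply: continuous_in_subspaceT => x; rewrite inE/= in_itv/= => /andP[sx _].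
  apply: cvgV; last exact: sqrt_continuous.
  by rewrite gt_eqF// sqrtr_gt0 (lt_le_trans s0).
- split.
  + by move=> x; rewrite in_itv/= => /andP[/ltW/dG[]].
  + by apply: cvg_at_right_filter; exact: cG.
  + by apply: cvg_at_left_filter; apply: cG; exact: ltW.
- move=> x; rewrite in_itv/= => /andP[/ltW/dG hx _].
  by rewrite derive1E derive_val.
Qed.

Variables (phi : R -> R) (lam : R).
Hypothesis phiE : eigenfun phi lam.
Hypothesis phi1 : inner01 phi phi = 1.
Let L := `|lam|.

(** Lets a kernel known only through a majorant [k] enter the weighted inequality. *)
Lemma dominated_Rintegral (A : set R) (H k : R -> R) (c : R) :
  measurable A -> A `<=` J -> 0 < c ->
  measurable_fun A k -> mu.-integrable A (EFin \o (fun x => k x ^+ 2)) ->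
  mu.-integrable A (EFin \o H) -> (forall x, A x -> `|H x| <= `|k x * phi x|) ->
  \int[mu]_(x in A) `|H x| <=
    (c * \int[mu]_(x in A) k x ^+ 2 + c^-1 * \int[mu]_(x in A) phi x ^+ 2) / 2.
Proof.
move=> mA AJ c0 mk ik iH Hk.
have [ikp] := @Rintegral_amgm R phi lam phiE A k c mA AJ c0 mk ik.
apply: le_trans; apply: le_Rintegral => //; exact: integrable_norm.
Qed.

Lemma Rintegral_phi2_cat (y : R) : 0 <= y -> y <= 1 ->
  \int[mu]_(x in `]0, y]) phi x ^+ 2 + \int[mu]_(x in `]y, 1]) phi x ^+ 2 = 1.
Proof.
move=> y0 y1; rewrite -(Rintegral_itvoc_cat _ _ _ _ _ y0 y1).
  exact: (Rintegral_phi2 R phi lam phiE phi1).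
exact: (integrable_phi2 R phi lam phiE).
Qed.

Lemma sub_itvl (y : R) : y <= 1 -> `]0, y] `<=` J.
Proof.
by move=> y1 z /=; rewrite !in_itv/= => /andP[-> zy]; exact: le_trans zy y1.
Qed.

Lemma sub_itvr (y : R) : 0 <= y -> `]y, 1] `<=` J.
Proof.
by move=> y0 z /=; rewrite !in_itv/= => /andP[yz ->]; rewrite (le_lt_trans y0 yz).
Qed.

Lemma measurable_invl (r : R) A : measurable_fun A (fun w : R => r * w^-1).
Proof.
by apply: measurable_funTS; apply: measurable_funM => //; exact: measurable_inv.
Qed.

(** The integral is split at z = y, where the bounds 1/4 and y/(4z) for K2 agree. Each half
    contributes at most y/16 to the integral of the squared majorant, and the two pieces of the
    integral of phi^2 add up to 1. *)
Lemma eigenfun_sqrt_decay (y : R) : 0 < y -> y <= 1 -> `|phi y| <= 3 / 8 * L ^+ 2 * Num.sqrt y.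
Proof.
move=> y0 y1.
have [mH ->] := @eigenfun_iterated R phi lam phiE phi1 y y0 y1.
rewrite normrM normrX -/L (mulrAC (3 / 8)) (mulrC _ (L ^+ 2)) ler_wpM2l ?sqr_ge0//.
set H := (fun z : R => saw2I y z * phi z) in mH *.
have K4 z : `|saw2I y z| <= 4^-1.
  by rewrite -[leRHS]mul1r; apply: saw2_head.
(* Here 1 + 1/z <= 2/z because z <= 1. *)
have Ky z : 0 < z -> z <= 1 -> `|saw2I y z| <= y / 4 * z^-1.
  move=> z0 z1; have z1' : 1 <= z^-1 by rewrite invf_ge1.
  apply: le_trans; first by apply: saw2_bound => //; rewrite invr_gt0.
  rewrite invfM invrK; nra.
have i4 (s t : R) : mu.-integrable `]s, t] (EFin \o (fun=> 4^-1 ^+ 2 : R)).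
  apply: (@bounded_integrable _ _ _ (4^-1 ^+ 2)); [by []|exact: itvoc_lty|by []|].
  by move=> z _; rewrite ger0_norm// sqr_ge0.
have iH : mu.-integrable J (EFin \o H).
  have [i4phi _] := @Rintegral_amgm R phi lam phiE J (fun=> 4^-1) 1 (measurable_itv _)
    (@subset_refl _ _) ltr01 (measurable_cst _) (i4 0 1).
  apply: (@le_integrable _ _ _ mu J _ _ (EFin \o (fun z => 4^-1 * phi z))).
  - by [].
  - exact/measurable_EFinP.
  - move=> z _ /=; rewrite lee_fin !normrM ler_wpM2r// (le_trans (K4 z))//.
    exact: ler_norm.
  - exact: i4phi.
rewrite (@Rintegral_itvoc_cat _ _ 0 y 1) ?(ltW y0)//.
apply: le_trans (ler_normD _ _) _.
have iH1 : mu.-integrable `]0, y] (EFin \o H).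
  by apply: integrableS iH => //; exact: sub_itvl.
have iH2 : mu.-integrable `]y, 1] (EFin \o H).
  by apply: integrableS iH => //; apply: sub_itvr; exact: ltW.
have sy : 0 < Num.sqrt y by rewrite sqrtr_gt0.
(* The optimal weight would be 2 sqrt 2 / sqrt y; this one keeps the constant rational: (2/8 +
   1/2)/2 = 3/8. *)
pose c := 2 / Num.sqrt y.
have c0 : 0 < c by rewrite divr_gt0.
have h1 : `|\int[mu]_(z in `]0, y]) H z| <=
   (c * (y / 16) + c^-1 * \int[mu]_(x in `]0, y]) phi x ^+ 2) / 2.
  apply: le_trans; first exact: le_normr_Rintegral.
  have -> : y / 16 = \int[mu]_(x in `]0, y]) (4^-1 ^+ 2).
    rewrite Rintegral_cst//= lebesgue_measure_itv/= lte_fin y0 -EFinB/= subr0.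
    by field.
  apply: (@dominated_Rintegral _ _ (fun=> 4^-1)) => //; first exact: sub_itvl.
  move=> z _ /=; rewrite !normrM ler_wpM2r// (le_trans (K4 z))//; exact: ler_norm.
have [i2 e2] := @Rintegral_invsq (y / 4) y 1 y0 y1.
have h2 : `|\int[mu]_(z in `]y, 1]) H z| <=
   (c * ((y / 4) ^+ 2 * (y^-1 - 1^-1)) + c^-1 * \int[mu]_(x in `]y, 1]) phi x ^+ 2) / 2.
  apply: le_trans; first exact: le_normr_Rintegral.
  rewrite -e2; apply: dominated_Rintegral => //.
  - by apply: sub_itvr; exact: ltW.
  - exact: measurable_invl.
  - move=> z /=; rewrite in_itv/= => /andP[yz z1].
    rewrite [leLHS]normrM [leRHS]normrM ler_wpM2r//.
    by apply: le_trans (ler_norm _); apply: Ky => //; exact: lt_trans yz.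
apply: le_trans (lerD h1 h2) _.
have E := Rintegral_phi2_cat y (ltW y0) y1.
have q : c * ((y / 4) ^+ 2 * (y^-1 - 1^-1)) <= c * (y / 16).
  rewrite ler_pM2l// invr1 (_ : _ * _ = y / 16 - y ^+ 2 / 16); last by field; rewrite gt_eqF.
  by rewrite gerBl divr_ge0// sqr_ge0.
have cy : c * (y / 16) = Num.sqrt y / 8.
  by rewrite /c -{2}(sqr_sqrtr (ltW y0)); field; rewrite gt_eqF.
have cV : c^-1 = Num.sqrt y / 2 by rewrite /c invf_div.
rewrite cy in q *; move: E q.
set q1 := \int[mu]_(x in `]0, y]) _; set q2 := \int[mu]_(x in `]y, 1]) _ => E q.
have -> : q2 = 1 - q1 by lra.
rewrite cV; lra.
Qed.

(** Below d = L^-2 the square-root decay gives at most (3/8) L^2 * 2 sqrt d = (3/4) L. Above d, the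
    weighted inequality with weight 1/L and the integral L^2 - 1 of y^-2 gives at most L. The bound
    is uniform in the cutoff e. *)
Lemma Rintegral_inv_eigenfun_le (e : R) : 0 < e -> e <= L ^- 2 ->
  mu.-integrable `]e, 1] (EFin \o (fun y => y^-1 * phi y)) /\
  \int[mu]_(y in `]e, 1]) `|y^-1 * phi y| <= 7 / 4 * L.
Proof.
move=> e0 eL; have L2 : 2 <= L := eigenvalue_ge2 R phi lam phiE phi1.
have L0 : 0 < L by lra.
set d := L ^- 2 in eL *.
have d1 : d <= 1 by rewrite invf_le1 ?exprn_gt0// expr_ge1//; lra.
have d0 : 0 < d by exact: lt_le_trans eL.
have e1 : e <= 1 by exact: le_trans d1.
have ip (s : R) : 0 < s -> s <= 1 -> mu.-integrable `]s, 1] (EFin \o (fun w => (1 * w^-1) ^+ 2)).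
  by move=> s0 s1; have [] := @Rintegral_invsq 1 s 1 s0 s1.
have [ii _] := @Rintegral_amgm R phi lam phiE `]e, 1] (fun w => 1 * w^-1) 1 (measurable_itv _)
    (sub_itvr _ (ltW e0)) ltr01 (measurable_invl 1 _) (ip _ e0 e1).
have {}ii : mu.-integrable `]e, 1] (EFin \o (fun y => y^-1 * phi y)).
  apply: eq_integrable ii => // z _; by rewrite /= mul1r.
split => //.
rewrite (@Rintegral_itvoc_cat _ _ e d 1)//; last exact: integrable_norm.
have h1 : \int[mu]_(y in `]e, d]) `|y^-1 * phi y| <= 3 / 4 * L.
  have [iq eq] := @Rintegral_invsqrt e d e0 eL.
  apply: (@le_trans _ _ (\int[mu]_(y in `]e, d]) (3 / 8 * L ^+ 2 * (Num.sqrt y)^-1))).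
    apply: le_Rintegral => //.
    - apply: integrable_norm; apply: integrableS ii => //.
      by move=> z /=; rewrite !in_itv/= => /andP[-> zd]; exact: le_trans d1.
    - exact: integrableZl_EFin.
    - move=> z /=; rewrite in_itv/= => /andP[ez zd].
      have z0 : 0 < z by exact: lt_trans ez.
      rewrite normrM ger0_norm ?invr_ge0 ?(ltW z0)// mulrC ler_pdivrMr//.
      apply: le_trans (eigenfun_sqrt_decay z z0 (le_trans zd d1)) _.
      rewrite -[leRHS]mulrA ler_wpM2l//; first by rewrite mulr_ge0// sqr_ge0.
      by rewrite mulrC ler_pdivlMr ?sqrtr_gt0// -expr2 sqr_sqrtr// ltW.
  rewrite RintegralZl// eq.
  have -> : Num.sqrt d = L^-1 by rewrite /d -exprVn sqrtr_sqr ger0_norm// invr_ge0 ltW.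
  have se : 0 <= 3 / 8 * L ^+ 2 * (2 * Num.sqrt e).
    by rewrite !mulr_ge0 ?sqrtr_ge0// ltW.
  rewrite mulrBr (_ : 3 / 8 * L ^+ 2 * (2 / L) = 3 / 4 * L); last by field; rewrite gt_eqF.
  by rewrite gerBl.
have [i2 e2] := @Rintegral_invsq 1 d 1 d0 d1.
have ii2 : mu.-integrable `]d, 1] (EFin \o (fun y => y^-1 * phi y)).
  apply: integrableS ii => // z /=; rewrite !in_itv/= => /andP[dz ->].
  by rewrite (le_lt_trans eL dz).
have h2 : \int[mu]_(y in `]d, 1]) `|y^-1 * phi y| <=
   (L^-1 * (1 ^+ 2 * (d^-1 - 1^-1)) + (L^-1)^-1 * \int[mu]_(x in `]d, 1]) phi x ^+ 2) / 2.
  rewrite -e2; apply: dominated_Rintegral => //.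
  - by apply: sub_itvr; exact: ltW.
  - by rewrite invr_gt0.
  - exact: measurable_invl.
  - by move=> z _; rewrite mul1r.
have E := Rintegral_phi2_cat d (ltW d0) d1.
have q0 : 0 <= \int[mu]_(x in `]0, d]) phi x ^+ 2.
  by apply: Rintegral_ge0 => z _; exact: sqr_ge0.
have q1 : \int[mu]_(x in `]d, 1]) phi x ^+ 2 <= 1 by rewrite -[leRHS]E lerDr.
rewrite (_ : 7 / 4 * L = 3 / 4 * L + L); last by field.
apply: lerD => //; apply: le_trans h2 _.
have -> : L^-1 * (1 ^+ 2 * (d^-1 - 1^-1)) = L - L^-1.
  by rewrite /d invrK; field; rewrite gt_eqF.
have L1 : 0 <= L^-1 by rewrite invr_ge0 ltW.
rewrite invrK ler_pdivrMr// mulr_natr mulr2n lerD//; first by rewrite gerBl.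
by rewrite ler_piMr// ltW.
Qed.

End Decay.

(** * Logarithmic sums and counting integers *)

Section LogSum.
Variable R : realType.
Implicit Types (s t a : R).

(** Profile of the bound on |phi y| / (L/2), to be taken at t = (3L/4)^2 y. *)
Definition gam t : R := Num.min 1 (Num.sqrt t).

(** The primitive of [gam t / t] that vanishes at 0. *)
Definition ell t : R := if t <= 1 then 2 * Num.sqrt t else 2 + ln t.

Lemma gam_ge0 t : 0 <= gam t.
Proof. by rewrite /gam le_min ler01 sqrtr_ge0. Qed.

Lemma gam_mono s t : s <= t -> gam s <= gam t.
Proof.
move=> st; have := ler_wsqrtr st.
by rewrite /gam le_min !ge_min lexx/= => ->; rewrite orbT.
Qed.

Lemma ell_ge0 t : 0 <= ell t.
Proof.
rewrite /ell; case: (leP t 1) => [_|t1]; first by rewrite mulr_ge0// sqrtr_ge0.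
by rewrite addr_ge0// ln_ge0// ltW.
Qed.

Lemma ellE t : 1 <= t -> ell t = 2 + ln t.
Proof.
rewrite /ell; case: (leP t 1) => // t1 t1'.
have -> : t = 1 by apply/eqP; rewrite eq_le t1 t1'.
by rewrite sqrtr1 ln1 mulr1 addr0.
Qed.

(** Heuristically, the right side is the integral of gam(u)/u over [s, t], hence at least gam(s)
    ln(t/s) >= gam(s) (1 - s/t). The proof stays algebraic: both points on one side of 1, or else 1
    inserted between them. *)
Lemma gam_step s t : 0 < s -> s <= t -> gam s * (1 - s / t) <= ell t - ell s.
Proof.
have small a b : 0 < a -> a <= b -> b <= 1 -> gam a * (1 - a / b) <= ell b - ell a.
  move=> a0 ab b1; have b0 : 0 < b by exact: lt_le_trans ab.
  rewrite /ell b1 (le_trans ab b1).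
  have r0 : 0 < Num.sqrt b by rewrite sqrtr_gt0.
  have q0 : 0 < Num.sqrt a by rewrite sqrtr_gt0.
  have qr : Num.sqrt a <= Num.sqrt b by exact: ler_wsqrtr.
  have ab1 : 0 <= 1 - a / b by rewrite subr_ge0 ler_pdivrMr// mul1r.
  apply: (@le_trans _ _ (Num.sqrt a * (1 - a / b))).
    by rewrite ler_wpM2r// /gam ge_min lexx orbT.
  rewrite -{2}(sqr_sqrtr (ltW a0)) -{1}(sqr_sqrtr (ltW b0)).
  set q := Num.sqrt a in q0 qr *; set r := Num.sqrt b in r0 qr *.
  have -> : q * (1 - q ^+ 2 / r ^+ 2) = (q * (r ^+ 2 - q ^+ 2)) / r ^+ 2.
    by field; rewrite gt_eqF.
  rewrite ler_pdivrMr ?exprn_gt0// subr_sqr.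
  have -> : q * ((r - q) * (r + q)) = (r - q) * (q * (r + q)) by ring.
  have -> : (2 * r - 2 * q) * r ^+ 2 = (r - q) * (2 * r ^+ 2) by ring.
  by rewrite ler_wpM2l ?subr_ge0//; nra.
have large a b : 0 < a -> a <= b -> 1 <= a -> gam a * (1 - a / b) <= ell b - ell a.
  move=> a0 ab a1; have b0 : 0 < b by exact: lt_le_trans ab.
  have b1 : 1 <= b by exact: le_trans ab.
  rewrite !ellE// (_ : 2 + ln b - _ = ln b - ln a); last by ring.
  have ab1 : 0 <= 1 - a / b by rewrite subr_ge0 ler_pdivrMr// mul1r.
  apply: (@le_trans _ _ (1 - a / b)).
    by rewrite ler_piMl// /gam ge_min lexx.
  have : ln (1 + (a / b - 1)) <= a / b - 1.
    by apply: le_ln1Dx; rewrite ltrBrDl subrr divr_gt0.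
  by rewrite addrC subrK ln_div ?posrE//; lra.
move=> s0 st; have t0 : 0 < t by exact: lt_le_trans st.
have [t1|t1] := leP t 1; first exact: small.
have [s1|s1] := leP 1 s; first exact: large.
have h1 := small s 1 s0 (ltW s1) (lexx _).
have h2 := large 1 t ltr01 (ltW t1) (lexx _).
have h3 : gam s <= gam 1 by apply: gam_mono; exact: ltW.
have h4 : 0 <= 1 - 1 / t by rewrite subr_ge0 ler_pdivrMr// mul1r ltW.
have h5 : gam s * (1 - 1 / t) <= gam 1 * (1 - 1 / t) by rewrite ler_wpM2r.
(* Equivalent to (1 - s)(1 - 1/t) >= 0 once [gam s] is factored out. *)
have h6 : gam s * (1 - s / t) <= gam s * (1 - s / 1) + gam s * (1 - 1 / t).
  rewrite -mulrDr ler_wpM2l ?gam_ge0//.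
  have : 0 <= (1 - s) * (1 - 1 / t) by rewrite mulr_ge0// subr_ge0 ltW.
  by rewrite divr1 div1r; lra.
by lra.
Qed.

(** For s = a/(m+1) and t = a/m the factor 1 - s/t of [gam_step] is 1/(m+1), so the increments of
    [ell] telescope. *)
Lemma sum_gam a (n N : nat) : 0 < a -> (0 < n)%N ->
  \sum_(n.+1 <= i < (n + N).+1) gam (a / i%:R) / i%:R <= ell (a / n%:R) - ell (a / (n + N)%:R).
Proof.
move=> a0 n0; elim: N => [|N IH]; first by rewrite addn0 big_geq// subrr.
rewrite addnS big_nat_recr/= ?ltnS ?leqW ?leq_addr//.
set m := (n + N)%N in IH *.
have m0 : (0 < m)%N by rewrite addn_gt0 n0.
have m0' : 0 < m%:R :> R by rewrite ltr0n.
have m1' : 0 < m.+1%:R :> R by rewrite ltr0n.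
have h : gam (a / m.+1%:R) * (1 - (a / m.+1%:R) / (a / m%:R)) <= ell (a / m%:R) - ell (a / m.+1%:R).
  by apply: gam_step; [rewrite divr_gt0|rewrite ler_pM2l// lef_pV2// ler_nat].
have E : 1 - (a / m.+1%:R) / (a / m%:R) = m.+1%:R^-1 :> R.
  by rewrite -(natr1 m); field; rewrite !gt_eqF// natr1.
rewrite E in h.
by apply: le_trans (lerD IH h) _; rewrite addrA subrK.
Qed.

(** Counts the integers in ]a, b] by indicators over a range fixed in advance, so that the sum can
    be exchanged with an integral. *)
Lemma floor_sum (a b : R) (N : nat) : 0 <= a -> a <= b -> b < N%:R ->
  (Num.floor b)%:~R - (Num.floor a)%:~R =
  \sum_(0 <= i < N) ((a < i%:R) && (i%:R <= b))%:R :> R.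
Proof.
(* Index 0 is counted too, whence the [+ 1]; it cancels in the difference. *)
have count c M : 0 <= c -> c < M%:R ->
    \sum_(0 <= i < M) (i%:R <= c :> R)%:R = (Num.floor c)%:~R + 1 :> R.
  move=> c0 cM.
  have /andP[h1 h2] := truncn_itv c0.
  have -> : (Num.floor c)%:~R = (Num.trunc c)%:R :> R.
    by rewrite (@floor_def _ _ (Posz (Num.trunc c)))// h1/= intrD natr1.
  set k := Num.trunc c in h1 h2 *.
  have kM : (k < M)%N by rewrite -(ltr_nat R) (le_lt_trans h1).
  rewrite (big_cat_nat (n := k.+1))//= big_nat (eq_bigr (fun=> 1)); last first.
    by move=> i /andP[_]; rewrite ltnS -(ler_nat R) => ik; rewrite (le_trans ik h1).
  rewrite -big_nat sumr_const_nat subn0 [X in _ + X]big_nat big1 ?addr0 ?natr1//.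
  move=> i /andP[ki _]; rewrite leNgt (lt_le_trans h2)// ler_nat//.
move=> a0 ab bN.
have -> : (Num.floor b)%:~R - (Num.floor a)%:~R =
   \sum_(0 <= i < N) ((i%:R <= b :> R)%:R - (i%:R <= a :> R)%:R) :> R.
  rewrite sumrB !count ?(le_lt_trans ab)// ?(le_trans a0)//; ring.
apply: eq_bigr => i _; case: (leP i%:R a) => [ia|ai]; last by rewrite subr0.
by rewrite (le_trans ia ab) subrr.
Qed.

End LogSum.
Arguments gam {R} t.
Arguments ell {R} t.

(** * Difference quotients *)

Section DifferenceQuotient.
Variable R : realType.
Notation mu := (@lebesgue_measure R).
Local Open Scope classical_set_scope.
Local Notation J := (`]0%R, 1%R] : set R).

Lemma Rintegral_sum_nat (A : set R) (f : nat -> R -> R) (N : nat) : measurable A ->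
  (forall i, mu.-integrable A (EFin \o f i)) ->
  mu.-integrable A (EFin \o (fun x => \sum_(0 <= i < N) f i x)) /\
  \int[mu]_(x in A) (\sum_(0 <= i < N) f i x) =
  \sum_(0 <= i < N) \int[mu]_(x in A) f i x.
Proof.
move=> mA fi; elim: N => [|N [IH1 IH2]].
  rewrite big_geq//.
  have -> : (fun x => \sum_(0 <= i < 0) f i x) = (fun=> 0).
    by apply/funext => x; rewrite big_geq.
  by rewrite Rintegral_cst// mul0r; split => //; exact: integrable0.
have -> : (fun x => \sum_(0 <= i < N.+1) f i x) =
          (fun x => \sum_(0 <= i < N) f i x + f N x).
  by apply/funext => x; rewrite big_nat_recr.
split; first exact: integrableD_EFin.
by rewrite RintegralD// IH2 big_nat_recr.
Qed.

Variables (phi : R -> R) (lam : R).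
Hypothesis phiE : eigenfun phi lam.
Hypothesis phi1 : inner01 phi phi = 1.
Let L := `|lam|.
(** Chosen so that (L/2) sqrt(C y) is the decay bound (3/8) L^2 sqrt y. *)
Let C := (3 / 4 * L) ^+ 2.

Let L2 : 2 <= L. Proof. exact: (eigenvalue_ge2 R phi lam phiE phi1). Qed.
Let L0 : 0 < L. Proof. exact: lt_le_trans L2. Qed.
Let C1 : 1 <= C. Proof. by rewrite /C; have := L2; nra. Qed.
Let C0 : 0 < C. Proof. exact: lt_le_trans C1. Qed.

Lemma eigenfun_gam (y : R) : 0 < y -> y <= 1 -> `|phi y| <= L / 2 * gam (C * y).
Proof.
move=> y0 y1; rewrite /gam.
have -> : Num.sqrt (C * y) = 3 / 4 * L * Num.sqrt y.
  rewrite sqrtrM ?sqr_ge0// sqrtr_sqr ger0_norm// mulr_ge0// ltW//.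
case: (leP 1 _) => _; first by rewrite mulr1; exact: (eigenfun_sup R phi lam phiE phi1).
apply: le_trans (eigenfun_sqrt_decay R phi lam phiE phi1 y y0 y1) _.
by rewrite -/L le_eqVlt; apply/orP; left; apply/eqP; field.
Qed.

(** For n > 0, the positive y with X/y < n <= X'/y. For n = 0 the convention [0^-1 = 0] makes it
    empty. *)
Definition band (X X' : R) (n : nat) : set R := `]X / n%:R, X' / n%:R].

(** The band has length (X' - X)/n, and y <= X'/n on it bounds |phi y| through [gam]. When 0 < n <=
    X it lies to the right of 1. *)
Lemma band_integral (e X X' : R) (n : nat) : 0 < e -> 0 < X -> X <= X' ->
  mu.-integrable `]e, 1] (EFin \o (fun y => \1_(band X X' n) y * `|phi y|)) /\
  \int[mu]_(y in `]e, 1]) (\1_(band X X' n) y * `|phi y|) <=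
  (X' - X) * (L / 2) * (if X < n%:R then gam (C * X' / n%:R) / n%:R else 0).
Proof.
move=> e0 X0 XX'.
have X'0 : 0 < X' by exact: lt_le_trans XX'.
set E := band X X' n.
have mE : measurable E by exact: measurable_itv.
have sub : `]e, 1] `<=` J by apply: sub_itvr; exact: ltW.
have i1E : mu.-integrable `]e, 1] (EFin \o (\1_E : R -> R)).
  apply: (@bounded_integrable _ _ _ 1) => //; first exact: itvoc_lty.
  by move=> y _; rewrite indicE; case: (y \in E); rewrite ?normr1 ?normr0.
have ii : mu.-integrable `]e, 1] (EFin \o (fun y => \1_E y * `|phi y|)).
  apply: (@bounded_integrable _ _ _ (L / 2)) => //; first exact: itvoc_lty.
    apply: measurable_funM => //.
    have := @measurableT_comp _ _ _ _ _ _ _ _ phi (@normr_measurable R setT).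
    apply; apply: (measurable_funS _ sub (measurable_phi R phi lam phiE)) => //.
  move=> y /sub/=; rewrite in_itv/= => /andP[y0 y1].
  have := eigenfun_sup R phi lam phiE phi1 y y0 y1.
  rewrite normrM normr_id indicE; case: (y \in E); rewrite ?normr1 ?mul1r//.
  by move=> _; rewrite normr0 mul0r divr_ge0// ltW.
split => //; case: ifPn => [Xn|]; last first.
  rewrite -leNgt mulr0 => nX.
  rewrite (@eq_Rintegral _ _ _ _ _ (fun=> 0)); first by rewrite Rintegral_cst// mul0r.
  move=> y; rewrite inE/= in_itv/= => /andP[ey y1].
  rewrite indicE memNset ?mul0r// /E /band/= in_itv/=.
  case: n nX @E mE i1E ii => [_|n nX] *.
    by rewrite invr0 !mulr0; case: (ltP 0 y) => //= y0; rewrite leNgt y0.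
  apply/negP; rewrite negb_and -leNgt; apply/orP; left.
  by apply: le_trans y1 _; rewrite ler_pdivlMr ?ltr0n// mul1r.
have n0 : 0 < n%:R :> R by exact: lt_trans Xn.
set c := L / 2 * gam (C * X' / n%:R).
have c0 : 0 <= c by rewrite mulr_ge0 ?gam_ge0// divr_ge0// ltW.
apply: (@le_trans _ _ (\int[mu]_(y in `]e, 1]) (c * \1_E y))).
  apply: le_Rintegral => //; first exact: integrableZl_EFin.
  move=> y /sub/=; rewrite in_itv/= => /andP[y0 y1].
  rewrite indicE; case: (boolP (y \in E)) => yE; last by rewrite mul0r mulr0.
  rewrite mul1r mulr1; apply: le_trans (eigenfun_gam y y0 y1) _.
  rewrite /c ler_wpM2l ?divr_ge0 ?(ltW L0)// gam_mono// -mulrA ler_pM2l//.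
  by move: yE; rewrite inE /E /band/= in_itv/= => /andP[].
rewrite RintegralZl//.
have -> : (X' - X) * (L / 2) * (gam (C * X' / n%:R) / n%:R) = c * ((X' - X) / n%:R).
  by rewrite /c; ring.
rewrite ler_wpM2l// /Rintegral integral_indic//.
have muE : (mu E = ((X' - X) / n%:R)%:E)%E.
  rewrite /E /band lebesgue_measure_itv/= lte_fin mulrBl.
  have [_|h] := ltP (X / n%:R) (X' / n%:R); first by rewrite EFinB.
  have -> : X / n%:R = X' / n%:R.
    by apply/eqP; rewrite eq_le h andbT ler_pM2r// invr_gt0.
  by rewrite subrr.
have muD : (mu (E `&` `]e, 1%R]) <= mu E)%E.
  by apply: le_measure; rewrite ?inE//; exact: measurableI.
rewrite -lee_fin fineK; first by rewrite -muE.
by rewrite ge0_fin_numE// (le_lt_trans muD)// muE ltry.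
Qed.

(** The first index above X contributes at most 1, since gam <= 1 and n >= 1. The later ones are
    bounded by [ell (C * X' / X)], which equals 2 + ln (C X'/X) as C X'/X >= 1. *)
Lemma band_sum (X X' : R) (N : nat) : 1 <= X -> X <= X' ->
  \sum_(0 <= i < ((Num.trunc X).+1 + N).+1)
    (if X < i%:R then gam (C * X' / i%:R) / i%:R else 0) <= 3 + ln (C * X' / X).
Proof.
move=> X1 XX'; set n := (Num.trunc X).+1.
have X0 : 0 < X by exact: lt_le_trans X1.
have X'0 : 0 < X' by exact: lt_le_trans XX'.
have /andP[h1 h2] := truncn_itv (ltW X0); rewrite -/n in h2.
have n1 : 1 <= n%:R :> R by rewrite ler1n.
have n0 : 0 < n%:R :> R by rewrite ltr0n.
rewrite (big_cat_nat (n := n))//=; last by rewrite leqW// leq_addr.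
rewrite big_nat big1 ?add0r; last first.
  move=> i /andP[_]; rewrite ltnS -(ler_nat R) => ik.
  by rewrite ltNge (le_trans ik h1).
rewrite big_nat_recl/= ?leq_addr// h2.
have CX0 : 0 < C * X' by rewrite mulr_gt0.
have := @sum_gam R (C * X') n N CX0 (ltn0Sn _).
rewrite big_add1/= => hs.
have hs' : \sum_(n <= i < n + N) (if X < i.+1%:R then gam (C * X' / i.+1%:R) / i.+1%:R else 0)
   <= ell (C * X' / n%:R).
  apply: le_trans (le_trans hs _); last by rewrite gerBl ell_ge0.
  apply: ler_sum_nat => i /andP[ni _].
  by rewrite (lt_le_trans h2)// ler_nat leqW.
have ht : gam (C * X' / n%:R) / n%:R <= 1.
  rewrite ler_pdivrMr// mul1r (le_trans _ n1)// /gam ge_min lexx//.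
(* Monotonicity of [ell] is read off [gam_step], whose left side is nonnegative. *)
have hm : ell (C * X' / n%:R) <= ell (C * X' / X).
  have q : C * X' / n%:R <= C * X' / X by rewrite ler_pM2l// lef_pV2// ltW.
  have p0 : 0 < C * X' / n%:R by rewrite divr_gt0.
  rewrite -subr_ge0; apply: le_trans (gam_step _ _ _ p0 q).
  by rewrite mulr_ge0 ?gam_ge0// subr_ge0 ler_pdivrMr ?mul1r// (lt_le_trans p0).
have e1 : ell (C * X' / X) = 2 + ln (C * X' / X).
  by apply: ellE; rewrite -mulrA -[leLHS]mulr1 ler_pM// ler_pdivlMr// mul1r.
by rewrite e1 in hm; lra.
Qed.

Lemma eigenfun_diff_le (x x' : R) : 0 < x' -> x' < x -> x <= 1 ->
  `|phi x' - phi x| <=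
  L ^+ 2 * (x'^-1 - x^-1) * (13 / 4 + ln (C * (x / x')) / 2).
Proof.
move=> x'0 x'x x1.
have x0 : 0 < x by exact: lt_trans x'x.
have x'1 : x' <= 1 by rewrite (le_trans (ltW x'x)).
set X := x^-1; set X' := x'^-1.
have X1 : 1 <= X by rewrite invf_ge1.
have XX' : X <= X' by rewrite lef_pV2 ?posrE// ltW.
have X0 : 0 < X by exact: lt_le_trans X1.
have X'0 : 0 < X' by exact: lt_le_trans XX'.
have D0 : 0 <= X' - X by rewrite subr_ge0.
have [i' _] := Rintegral_saw_phi R phi lam phiE phi1 X'.
have [i _] := Rintegral_saw_phi R phi lam phiE phi1 X.
rewrite (eigenfun_saw R phi lam phiE phi1 x' x'0 x'1) (eigenfun_saw R phi lam phiE phi1 x x0 x1).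
rewrite -mulrBr normrM -/L -/X -/X' -RintegralB//.
have iB := @integrableB_EFin R J _ _ (measurable_itv _) i' i.
(* The constant is 13/4 = 7/4 + 3/2, from the continuous part and from the jumps. *)
have -> : L ^+ 2 * (X' - X) * (13 / 4 + ln (C * (x / x')) / 2) =
    L * ((X' - X) * (7 / 4 * L) + (X' - X) * (L / 2) * (3 + ln (C * X' / X))).
  by rewrite (_ : C * X' / X = C * (x / x')); [field|rewrite /X invrK mulrAC mulrA].
rewrite ler_pM2l//.
apply/ler_addgt0Pr => eta eta0.
(* On ]0, e] the two sawtooth values differ by at most 1 and |phi| <= L/2, so this piece costs at
   most eta. Away from 0 only finitely many bands matter. *)
pose e := Num.min (L ^- 2) (eta / (L / 2)).
have L20 : 0 < L / 2 by rewrite divr_gt0.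
have e0 : 0 < e by rewrite lt_min invr_gt0 exprn_gt0// divr_gt0.
have eL : e <= L ^- 2 by rewrite ge_min lexx.
have ee : e * (L / 2) <= eta by rewrite -ler_pdivlMr// ge_min lexx orbT.
have e1 : e <= 1.
  by apply: le_trans eL _; rewrite invf_le1 ?exprn_gt0// expr_ge1//; have := L2; lra.
have sub1 : `]0, e] `<=` J by exact: sub_itvl.
have sub2 : `]e, 1] `<=` J by apply: sub_itvr; exact: ltW.
rewrite (@Rintegral_itvoc_cat _ _ 0 e 1) ?(ltW e0)//.
apply: le_trans (ler_normD _ _) _; rewrite addrC; apply: lerD; last first.
  apply: le_trans ee; apply: le_trans.
    by apply: le_normr_Rintegral => //; exact: integrableS iB.
  have -> : e * (L / 2) = \int[mu]_(y in `]0, e]) (L / 2).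
    by rewrite Rintegral_cst//= lebesgue_measure_itv/= lte_fin e0 -EFinB/= subr0 mulrC.
  apply: le_Rintegral => //.
  - by apply: integrable_norm; exact: integrableS iB.
  - apply: (@bounded_integrable _ _ _ (L / 2)); [by []|exact: itvoc_lty|by []|].
    by move=> y _; rewrite ger0_norm// ltW.
  move=> y /sub1/=; rewrite in_itv/= => /andP[y0 y1].
  rewrite -mulrBl normrM -[leRHS]mul1r; apply: ler_pM => //; last first.
    exact: (eigenfun_sup R phi lam phiE phi1).
  have := saw_norm R (X' / y); have := saw_norm R (X / y).
  by rewrite !ler_norml => /andP[? ?] /andP[? ?]; apply/andP; split; lra.
pose n := (Num.trunc X).+1.
(* For y > e every integer up to X'/y is below N; the shape of N is the range of [band_sum]. *)
pose N := (n + Num.bound (X' / e)).+1.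
have NX : X' / e < N%:R.
  apply: lt_le_trans (archi_boundP _) _; first by rewrite divr_ge0// ltW.
  by rewrite ler_nat /N leqW// leq_addl.
have bi k := band_integral e X X' k e0 X0 XX'.
have [isum es] := @Rintegral_sum_nat `]e, 1] (fun k y => \1_(band X X' k) y * `|phi y|) N
  (measurable_itv _) (fun k => (bi k).1).
have [iw hw] := Rintegral_inv_eigenfun_le R phi lam phiE phi1 e e0 eL.
have iw1 := @integrableZl_EFin R _ (X' - X) _ (measurable_itv _) (integrable_norm iw).
have ib2 : mu.-integrable `]e, 1] (EFin \o (fun y => saw (X' / y) * phi y - saw (X / y) * phi y)).
  exact: integrableS iB.
apply: le_trans; first exact: le_normr_Rintegral.
apply: (@le_trans _ _ (\int[mu]_(y in `]e, 1]) ((X' - X) * `|y^-1 * phi y| +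
   \sum_(0 <= k < N) \1_(band X X' k) y * `|phi y|))).
  apply: le_Rintegral => //.
  - exact: integrable_norm.
  - exact: integrableD_EFin.
  move=> y; rewrite /= in_itv/= => /andP[ey y1].
  have y0 : 0 < y by exact: lt_trans ey.
  rewrite -mulrBl normrM normrM mulrA -mulr_suml -mulrDl ler_wpM2r//.
  have -> : saw (X' / y) - saw (X / y) = - ((X' - X) * y^-1) +
      ((Num.floor (X' / y))%:~R - (Num.floor (X / y))%:~R).
    by rewrite /saw /fracR mulrBl; ring.
  rewrite (@floor_sum R (X / y) (X' / y) N); last first.
  - by apply: le_lt_trans NX; rewrite ler_pM2l// lef_pV2// ltW.
  - by rewrite ler_pM2r// invr_gt0.
  - by rewrite divr_ge0// ltW.
  apply: le_trans (ler_normD _ _) _; rewrite normrN normrM (ger0_norm D0).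
  rewrite lerD2l ger0_norm; last by apply: sumr_ge0.
  apply: ler_sum => k _; rewrite indicE; case: (boolP (_ && _)) => // /andP[k1 k2].
  have k0 : 0 < k%:R :> R by apply: lt_trans k1; rewrite divr_gt0.
  rewrite mem_set// /band/= in_itv/= ltr_pdivrMr// ler_pdivlMr// mulrC.
  by rewrite -ltr_pdivrMr// k1 -ler_pdivlMr.
rewrite RintegralD// RintegralZl//; last exact: integrable_norm.
apply: lerD; first by rewrite ler_wpM2l.
rewrite es; apply: (@le_trans _ _ (\sum_(0 <= k < N) (X' - X) * (L / 2) *
    (if X < k%:R then gam (C * X' / k%:R) / k%:R else 0))).
  by apply: ler_sum => k _; have [] := bi k.
have DL : 0 <= (X' - X) * (L / 2) by rewrite mulr_ge0// ltW.
by rewrite -mulr_sumr ler_wpM2l//; apply: band_sum.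
Qed.

End DifferenceQuotient.

(** * The derivative bound *)

Lemma ln_3_4_lt (R : realType) : ln (3 / 4 : R) < - 4^-1.
Proof.
(* Applied to 3/4 directly, ln(1 + u) <= u gives only the non-strict bound -1/4. The factors 9/10
   and 5/6 give -4/15, and this gap makes the final inequality strict. *)
rewrite (_ : 3 / 4 = (1 + - 10^-1) * (1 + - 6^-1) :> R); last by field.
have h1 : ln (1 + - 10^-1 : R) <= - 10^-1 by apply: le_ln1Dx; lra.
have h2 : ln (1 + - 6^-1 : R) <= - 6^-1 by apply: le_ln1Dx; lra.
by rewrite lnM ?posrE; lra.
Qed.

Theorem theorem4p6 (R : realType) (phi : nat -> R -> R) (lam : nat -> R) :
  eigen_system phi lam ->
  forall (j : nat) (x d : R), 0 < x -> x <= 1 ->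
  has_deriv01 (phi j) x d ->
  `|d| < (3 + ln `|lam j|) * lam j ^+ 2 / x ^+ 2.
Proof.
move=> [eig [orth _]] j x d x0 x1 hd.
have [lam0 phiE] := eig j.
have phi1 : inner01 (phi j) (phi j) = 1 by rewrite orth eqxx.
set L := `|lam j|.
have L0 : 0 < L by rewrite normr_gt0.
(* Only the left-hand limit is used, which covers x < 1 and x = 1 alike. *)
have cvd : ((fun h : R => h^-1 * (phi j (x + h) - phi j x)) @ (0:R)^'- --> d)%classic.
  by move: hd; rewrite /has_deriv01; case: ifP => // _; exact: cvg_dnbhs_at_left.
have cvn := cvg_norm cvd.
pose C : R := (3 / 4 * L) ^+ 2.
have C0 : 0 < C by rewrite exprn_gt0// mulr_gt0.
(* Bound on the difference quotient: (1/(x+h) - 1/x)/(-h) = 1/(x (x+h)). *)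
pose B (h : R) := L ^+ 2 * (x * (x + h))^-1 * (13 / 4 + ln (C * (x / (x + h))) / 2).
have cvB : (B h @[h --> (0:R)^'-] --> B 0)%classic.
  apply: cvg_at_left_filter.
  have cx : (x + h @[h --> (0 : R)] --> x + 0)%classic.
    by apply: cvgD; [exact: cvg_cst|exact: cvg_id].
  have x00 : x + 0 != 0 by rewrite addr0 gt_eqF.
  apply: cvgM.
    apply: cvgM; first exact: cvg_cst.
    apply: cvgV; first by rewrite mulf_neq0// gt_eqF.
    by apply: cvgM; [exact: cvg_cst|].
  apply: cvgD; first exact: cvg_cst.
  apply: cvgM; last exact: cvg_cst.
  apply: (@continuous_cvg _ _ _ _ _ _ (@ln R)).
    by apply: continuous_ln; rewrite addr0 mulr_gt0// divr_gt0.
  apply: cvgM; first exact: cvg_cst.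
  apply: cvgM; first exact: cvg_cst.
  exact: cvgV.
have dB : `|d| <= B 0.
  apply: (@ler_cvg_to _ ((0 : R)^'-)%classic _ _
    (fun h : R => `|h^-1 * (phi j (x + h) - phi j x)|) B); [exact: cvn|exact: cvB|near=> h].
  have h0 : h < 0 by near: h; exact: nbhs_left_lt.
  have xh0 : 0 < x + h.
    by rewrite -ltrBlDl sub0r; near: h; apply: nbhs_left_gt; rewrite oppr_lt0.
  have xhx : x + h < x by rewrite gtrDl.
  have := eigenfun_diff_le R (phi j) (lam j) phiE phi1 x (x + h) xh0 xhx x1.
  rewrite -/L -/C normrM normfV (ltr0_norm h0) ler_pdivrMl ?oppr_gt0//.
  rewrite (_ : - h * B h = L ^+ 2 * ((x + h)^-1 - x^-1) * (13 / 4 + ln (C * (x / (x + h))) / 2))//.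
  by rewrite /B; field; rewrite !gt_eqF.
apply: le_lt_trans dB _; rewrite /B addr0 divff ?gt_eqF// mulr1.
rewrite -(real_normK (num_real (lam j))) -/L.
(* Hence [B 0] is L^2/x^2 times 13/4 + ln (3/4) + ln L. *)
have -> : ln C = 2 * (ln (3 / 4) + ln L).
  have h34 : 0 < 3 / 4 :> R by lra.
  rewrite /C lnXn; last exact: mulr_gt0.
  have -> : ln (3 / 4 * L) = ln (3 / 4) + ln L by rewrite lnM// posrE.
  by rewrite [RHS]mulr_natl.
rewrite -(expr2 x) -[ltRHS]mulrA [ltRHS]mulrC.
have LX : 0 < L ^+ 2 / x ^+ 2 by rewrite divr_gt0// exprn_gt0.
rewrite ltr_pM2l//.
by have := ln_3_4_lt R; lra.
Unshelve. all: by end_near. Qed.
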